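(* Let $S(16)$ denote the set of all values of integer circulant determinants of order $16$. Then \begin{align*} S(16) = \mathbb{Z}_{\rm odd} &\cup 128\mathbb{Z} \\ &\cup \{ 64 p m \mid p \text{ prime},\ p = a^2+b^2 \equiv 1 \pmod 8 \text{ with } a,b\in\mathbb{Z},\ a+b \equiv 3 \text{ or } 5 \pmod 8,\ m\in\mathbb{Z}\} \\ &\cup \{ 64 p m \mid p \text{ prime},\ p\equiv 5 \pmod 8,\ m \in \mathbb{Z}\} \\ &\cup \{ 64 p^2 m \mid p \text{ prime},\ p \equiv 3 \pmod 8,\ m\in\mathbb{Z}\}. \end{align*}
   Context: For integers $a_0,\dots,a_{15}$, the circulant determinant $D(a_0,\dots,a_{15})$ is the determinant of the $16\times 16$ matrix whose $(i,j)$ entry ($0\le i,j\le 15$) is $a_{(i-j)\bmod 16}$; i.e. the first row is $a_0, a_{15}, \dots, a_1$, the second row is $a_1, a_0, \dots, a_2$, and so on. $S(16) := \{D(a_0,\dots,a_{15}) \mid a_i\in\mathbb{Z}\}$. $\mathbb{Z}_{\rm odd}$ denotes the set of all odd integers. *)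

(* Defs.v *)
From HB Require Import structures.
From mathcomp Require Import all_boot all_order all_algebra.
From mathcomp Require Import classical_sets.

Set Implicit Arguments.
Unset Strict Implicit.
Unset Printing Implicit Defensive.

Import Order.TTheory GRing.Theory Num.Theory.

Local Open Scope classical_set_scope.
Local Open Scope ring_scope.

(* The subtraction [i - j] is that of the group ['I_16] of integers mod 16. *)
Definition circulant16 (a : 'I_16 -> int) : 'M[int]_16 :=
  \matrix_(i < 16, j < 16) a (i - j).

Definition D16 (a : 'I_16 -> int) : int := \det (circulant16 a).

Definition S16 : set int := [set D16 a | a in [set: 'I_16 -> int]].

Definition Zodd : set int := [set n | ~~ (2 %| n)%Z].

Definition primes_sum_sq_1mod8 : set nat :=
  [set p | prime p /\ p = 1 %[mod 8] /\
     exists a b : int, p%:Z = a ^+ 2 + b ^+ 2 /\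
       ((a + b = 3 %[mod 8])%Z \/ (a + b = 5 %[mod 8])%Z)].

(* Main.v *)
Require Import Defs.
From mathcomp Require Import all_boot all_order all_algebra all_field.
From mathcomp Require Import classical_sets.
From mathcomp Require Import zify ring.

(** The determinant factors as [f(1) f(-1) N(f(i)) N(f(zeta_8)) N(f(zeta_16))],
    where [f] is the polynomial with coefficients [a_0, ..., a_15], and each of
    the last three norms is a sum of two squares: the norm down to [Z[i]] of
    [f(i)], [f(zeta_8)], [f(zeta_16)] is some [x + y i], and if the determinant
    is even but not divisible by 128, then [x] and [y] are odd.

    The values of [f] at these roots are congruent modulo the primes above 2.
    For a determinant equal to 64 times an odd number this forces
    [f(1) f(-1) = 8 mod 16], and then, going from [i] to [zeta_8] and to
    [zeta_16], that one of the three pairs [(x, y)] contains a number congruent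
    to 3 or 5 modulo 8.  As the odd Gaussian integers [a + b i] of norm 1 modulo
    8 with [a + b = 1] or [-1 mod 8] form a group modulo 8, that [x ^ 2 + y ^ 2]
    has one of the prime divisors of the statement.

    Conversely, [f] can be chosen with prescribed residues: [N(f(i)) = 2 p]
    realizes [64 p] for [p = 5 mod 8], and [N(f(zeta_8))] realizes [2 p] for
    [p = 1 mod 8] (because [Z[zeta_8]] is Euclidean for the norm) and [2 p ^ 2]
    for [p = a ^ 2 + 2 b ^ 2 = 3 mod 8]. *)

Set Implicit Arguments.
Unset Strict Implicit.
Unset Printing Implicit Defensive.

Import Order.TTheory GRing.Theory Num.Theory.

Local Open Scope classical_set_scope.
Local Open Scope ring_scope.

(** * Factorization of the determinant *)

Section CirculantFactorization.

Variable R : comNzRingType.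
Implicit Types (a c e : nat -> R) (z w : R) (n : nat).

(* If [a] lists the coefficients of a polynomial modulo [x ^ (2 n) - 1], then
   [fold_add n a] and [fold_sub n a] reduce it modulo [x ^ n - 1], [x ^ n + 1]. *)
Definition fold_add n a i := a i + a (i + n)%N.
Definition fold_sub n a i := a i - a (i + n)%N.

(* Real and imaginary parts of the relative norm from Z[zeta_8] to Z[i] of
   [e_0 + e_1 zeta_8 + e_2 zeta_8 ^ 2 + e_3 zeta_8 ^ 3]. *)
Definition gauss_re e := e 0%N ^+ 2 - e 2%N ^+ 2 + 2 * e 1%N * e 3%N.
Definition gauss_im e := 2 * e 0%N * e 2%N - e 1%N ^+ 2 + e 3%N ^+ 2.
Definition norm8 e := gauss_re e ^+ 2 + gauss_im e ^+ 2.

(* Coordinates of the relative norm from Z[zeta_16] to Z[zeta_8]. *)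
Definition relnorm16 c : nat -> R := nth 0
  [:: c 0%N ^+ 2 - c 4%N ^+ 2 - 2 * c 2%N * c 6%N + 2 * c 1%N * c 7%N
        + 2 * c 3%N * c 5%N;
      2 * c 0%N * c 2%N - 2 * c 4%N * c 6%N - c 1%N ^+ 2 + c 5%N ^+ 2
        + 2 * c 3%N * c 7%N;
      2 * c 0%N * c 4%N + c 2%N ^+ 2 - c 6%N ^+ 2 - 2 * c 1%N * c 3%N
        + 2 * c 5%N * c 7%N;
      2 * c 0%N * c 6%N + 2 * c 2%N * c 4%N - 2 * c 1%N * c 5%N - c 3%N ^+ 2
        + c 7%N ^+ 2].

(** The intermediate families are the reductions of the polynomial [f]: [b] and [c] modulo
    [x ^ 8 - 1] and [x ^ 8 + 1], [w] and [e] modulo [x ^ 4 - 1] and [x ^ 4 + 1], [h] and [g] modulo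
    [x ^ 2 - 1] and [x ^ 2 + 1]. The first factor is [f(1) f(-1)]. *)
Definition det16 a : R :=
  let c := fold_sub 8 a in let b := fold_add 8 a in
  let e := fold_sub 4 b in let w := fold_add 4 b in
  let g := fold_sub 2 w in let h := fold_add 2 w in
  (h 0%N ^+ 2 - h 1%N ^+ 2) * (g 0%N ^+ 2 + g 1%N ^+ 2)
    * norm8 e * norm8 (relnorm16 c).

Definition pol n a z := \sum_(i < n) a i * z ^+ i.

Lemma pol_fold n a z s : z ^+ n = s ->
  pol (n + n) a z = pol n (fun i => a i + s * a (i + n)%N) z.
Proof.
move=> zn; rewrite /pol big_split_ord /=.
under [RHS]eq_bigr => i _ do rewrite mulrDl.
rewrite big_split /=; congr (_ + _).
by apply: eq_bigr => i _; rewrite exprD zn [(n + i)%N]addnC; ring.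
Qed.

Lemma pol_fold_add n a z : z ^+ n = 1 ->
  pol (n + n) a z = pol n (fold_add n a) z.
Proof.
move/(pol_fold a) ->; apply: eq_bigr => i _; congr (_ * _).
by rewrite mul1r.
Qed.

Lemma pol_fold_sub n a z : z ^+ n = -1 ->
  pol (n + n) a z = pol n (fold_sub n a) z.
Proof.
move/(pol_fold a) ->; apply: eq_bigr => i _; congr (_ * _).
by rewrite mulN1r.
Qed.

(** Here [z ^ 2] plays the role of [i], and the conjugation [z -> - z] fixes it. *)
Lemma pol4_pair e z : z ^+ 4 = -1 ->
  pol 4 e z * pol 4 e (- z) = gauss_re e + gauss_im e * z ^+ 2.
Proof.
move=> z4; rewrite /pol !big_ord_recr !big_ord0 /= /gauss_re /gauss_im.
(* The intermediate form exposes [z ^ 4]: reaching it is a pure ring identity, after which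
   [z ^ 4 = -1] is substituted. *)
apply: (@etrans _ _ (e 0%N ^+ 2 + (2 * e 0%N * e 2%N - e 1%N ^+ 2) * z ^+ 2
  + (e 2%N ^+ 2 - 2 * e 1%N * e 3%N) * z ^+ 4 - e 3%N ^+ 2 * z ^+ 2 * z ^+ 4)).
  by ring.
by rewrite z4; ring.
Qed.

Lemma pol4_norm e z : z ^+ 4 = -1 ->
  pol 4 e z * pol 4 e (- z) * (pol 4 e (z ^+ 3) * pol 4 e (- z ^+ 3))
  = norm8 e.
Proof.
move=> z4; have z12 : (z ^+ 3) ^+ 4 = -1 by rewrite exprAC z4; ring.
rewrite !pol4_pair // /norm8.
(* The root [z ^ 3] lies over [- i], so the second pair gives the complex conjugate of the first. *)
have -> : (z ^+ 3) ^+ 2 = - z ^+ 2.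
  by rewrite -exprM (exprD z 4 2) z4 mulN1r.
apply: (@etrans _ _ (gauss_re e ^+ 2 - gauss_im e ^+ 2 * z ^+ 4)); first by ring.
by rewrite z4; ring.
Qed.

Lemma pol8_pair c z : z ^+ 8 = -1 ->
  pol 8 c z * pol 8 c (- z) = pol 4 (relnorm16 c) (z ^+ 2).
Proof.
move=> z8; rewrite /pol !big_ord_recr !big_ord0 /=.
apply: (@etrans _ _ (
  c 0%N ^+ 2 + (2 * c 0%N * c 2%N - c 1%N ^+ 2) * z ^+ 2
  + (2 * c 0%N * c 4%N + c 2%N ^+ 2 - 2 * c 1%N * c 3%N) * z ^+ 4
  + (2 * c 0%N * c 6%N + 2 * c 2%N * c 4%N - 2 * c 1%N * c 5%N - c 3%N ^+ 2)
    * z ^+ 6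
  + z ^+ 8 * (c 4%N ^+ 2 + 2 * c 2%N * c 6%N - 2 * c 1%N * c 7%N
    - 2 * c 3%N * c 5%N
  + (2 * c 4%N * c 6%N - c 5%N ^+ 2 - 2 * c 3%N * c 7%N) * z ^+ 2
  + (c 6%N ^+ 2 - 2 * c 5%N * c 7%N) * z ^+ 4 - c 7%N ^+ 2 * z ^+ 6))).
  by ring.
by rewrite z8 /relnorm16 /=; ring.
Qed.

Lemma prod_pol16 a w : w ^+ 8 = -1 ->
  \prod_(k < 16) pol 16 a (w ^+ k) = det16 a.
Proof.
(* The powers of [w] pair up as [z, - z]. The pairs with [k = 0], [k = 4], [k = 2, 6] and [k] odd
   yield the four factors in this order. *)
move=> w8; have w8D k : w ^+ (8 + k) = - w ^+ k by rewrite exprD w8 mulN1r.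
rewrite (@big_split_ord _ _ _ 8 8) /=.
under [X in _ * X = _]eq_bigr => i _ do rewrite w8D.
rewrite !big_ord_recr !big_ord0 /= !mul1r expr0 expr1.
set b := fold_add 8 a; set c := fold_sub 8 a; set f := pol 16 a.
have pow k x : w ^+ 8 = x -> (w ^+ k) ^+ 8 = x ^+ k by move=> <-; rewrite exprAC.
have podd z : z ^+ 8 = -1 ->
    f z * f (- z) = pol 4 (relnorm16 c) (z ^+ 2).
  move=> z8; rewrite /f !(@pol_fold_sub 8) ?pol8_pair //.
  by rewrite exprNn z8; ring.
have peven z : z ^+ 8 = 1 -> f z = pol 8 b z by apply: pol_fold_add.
clearbody f.
have p2odd z : z ^+ 4 = -1 -> f z = pol 4 (fold_sub 4 b) z.
  move=> z4; rewrite peven ?(@pol_fold_sub 4) //.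
  by rewrite (exprM z 4 2) z4; ring.
have p2even z : z ^+ 4 = 1 -> f z = pol 4 (fold_add 4 b) z.
  move=> z4; rewrite peven ?(@pol_fold_add 4) //.
  by rewrite (exprM z 4 2) z4; ring.
have e1 : f 1 * f (- 1)
    = fold_add 2 (fold_add 4 b) 0%N ^+ 2 - fold_add 2 (fold_add 4 b) 1%N ^+ 2.
  rewrite !p2even ?(@pol_fold_add 2) ?expr1n //; try by ring.
  by rewrite /pol !big_ord_recr !big_ord0 /=; ring.
set g := fold_sub 2 (fold_add 4 b).
have p1odd z : z ^+ 2 = -1 -> f z = g 0%N + g 1%N * z.
  move=> z2; have z4 : z ^+ 4 = 1 by rewrite (exprM z 2 2) z2; ring.
  rewrite (p2even _ z4) (@pol_fold_sub 2) // -/g.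
  by rewrite /pol !big_ord_recr big_ord0 /=; ring.
have e4 z : z ^+ 2 = -1 -> f z * f (- z) = g 0%N ^+ 2 + g 1%N ^+ 2.
  move=> z2; rewrite (p1odd _ z2) p1odd ?sqrrN //.
  apply: (@etrans _ _ (g 0%N ^+ 2 - g 1%N ^+ 2 * z ^+ 2)); first by ring.
  by rewrite z2; ring.
have {}e4 := e4 (w ^+ 4) (etrans (esym (exprM w 4 2)) w8).
have e2 : f (w ^+ 2) * f (- w ^+ 2)
    * (f (w ^+ 6) * f (- w ^+ 6)) = norm8 (fold_sub 4 b).
  have w2 : (w ^+ 2) ^+ 4 = -1 by rewrite -exprM.
  have w6 : (w ^+ 6) ^+ 4 = -1 by rewrite (exprM w 2 3) exprAC w2; ring.
  have sgn z : z ^+ 4 = -1 -> (- z) ^+ 4 = -1 by move=> <-; ring.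
  by rewrite -(pol4_norm _ w2) -exprM !(p2odd _ w2, p2odd _ w6,
    p2odd _ (sgn _ w2), p2odd _ (sgn _ w6)).
have eodd : f w * f (- w) * (f (w ^+ 3) * f (- w ^+ 3))
    * (f (w ^+ 5) * f (- w ^+ 5)
    * (f (w ^+ 7) * f (- w ^+ 7))) = norm8 (relnorm16 c).
  have w2 : (w ^+ 2) ^+ 4 = -1 by rewrite -exprM.
  have sgn k : odd k -> (w ^+ k) ^+ 8 = -1.
    by move=> ok; rewrite (pow _ _ w8) -signr_odd ok expr1.
  rewrite (podd _ w8) (podd _ (sgn 3 isT)) (podd _ (sgn 5 isT)) (podd _ (sgn 7 isT)).
  rewrite -(pol4_norm _ w2) -!exprM (w8D 2) (w8D 6).
  by rewrite mulrACA.
rewrite /det16 -/b -/c -/g -e1 -e4 -e2 -eodd. ring.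
Qed.
End CirculantFactorization.

(** * Transfer along ring morphisms to the integer determinant *)

Section Morphism.

Variables (R S : comNzRingType) (f : {rmorphism R -> S}).
Implicit Types (a c e : nat -> R).

Lemma fold_add_rmorph n a : f \o fold_add n a = fold_add n (f \o a).
Proof. by apply: boolp.funext => i; rewrite /= /fold_add rmorphD. Qed.

Lemma fold_sub_rmorph n a : f \o fold_sub n a = fold_sub n (f \o a).
Proof. by apply: boolp.funext => i; rewrite /= /fold_sub rmorphB. Qed.

Lemma norm8_rmorph e : f (norm8 e) = norm8 (f \o e).
Proof.
rewrite /norm8 /gauss_re /gauss_im /=.
by rewrite !(rmorphXn, rmorph_nat, rmorphN, rmorphD, rmorphM).
Qed.

Lemma relnorm16_rmorph c : f \o relnorm16 c = relnorm16 (f \o c).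
Proof.
apply: boolp.funext => -[|[|[|[|i]]]] /=; last by rewrite /relnorm16 /= !nth_nil rmorph0.
all: by rewrite /relnorm16 /= !(rmorphXn, rmorph_nat, rmorphN, rmorphD, rmorphM).
Qed.

Lemma det16_rmorph a : f (det16 a) = det16 (f \o a).
Proof.
rewrite /det16 -!(fold_add_rmorph, fold_sub_rmorph) -relnorm16_rmorph.
rewrite -!norm8_rmorph /=.
by rewrite !rmorphM rmorphB rmorphD !rmorphXn.
Qed.

End Morphism.

(** The rows of the Fourier matrix are left eigenvectors of a circulant matrix, with the values of
    its polynomial at the powers of [w] as eigenvalues. *)
Lemma mulmx_dft_circulant16 (w : algC) (a : nat -> int) : w ^+ 16 = 1 ->
  let V : 'M_16 := (Vandermonde 16 (\row_(k < 16) w ^+ k))^T in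
  V *m map_mx intr (circulant16 (fun i => a i))
  = diag_mx (\row_k pol 16 (intr \o a) (w ^+ k)) *m V.
Proof.
move=> w16 V; apply/matrixP => k j.
rewrite mul_diag_mx !mxE /pol mulr_suml (reindex_inj (addIr j)) /=.
apply: eq_bigr => l _; rewrite !mxE addrK mulrC -mulrA; congr (_ * _).
rewrite -exprD; apply: (@expr_mod _ 16); by rewrite exprAC w16 expr1n.
Qed.

(** On taking determinants in the Fourier relation over [algC], the nonzero Vandermonde determinant
    cancels; the identity descends to integers by injectivity of [intr]. *)
Lemma D16E (a : nat -> int) : D16 (fun i => a i) = det16 a.
Proof.
have [w wP] := C_prim_root_exists (isT : (0 < 16)%N).
have w16 := prim_expr_order wP.
have w8 : w ^+ 8 = -1.
  have /eqP : (w ^+ 8) ^+ 2 = 1 by rewrite -exprM.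
  rewrite sqrf_eq1 => /orP[w8|/eqP//].
  by have := eq_prim_root_expr wP 8 0; rewrite expr0 w8.
apply: (@intr_inj algC).
have /(congr1 determinant) := mulmx_dft_circulant16 a w16.
rewrite /= !det_mulmx det_map_mx det_diag det_tr mulrC.
under [X in _ = X * _]eq_bigr => k _ do rewrite mxE.
rewrite (prod_pol16 _ w8) -(det16_rmorph intr) => /mulIf; apply.
rewrite det_Vandermonde; apply/prodf_neq0 => i _; apply/prodf_neq0 => j ij.
rewrite !mxE subr_eq0 (eq_prim_root_expr wP) !modn_small //.
by rewrite eq_sym neq_ltn ij.
Qed.

Lemma S16P (n : int) : S16 n <-> exists a : nat -> int, det16 a = n.
Proof.
split=> [[a _ <-]|[a <-]].
  exists (fun k => a (inord k)); rewrite -D16E; congr D16.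
  by apply: boolp.funext => i; rewrite inord_val.
by exists (fun i : 'I_16 => a i); rewrite ?D16E.
Qed.

(** The product of two circulant matrices is the circulant matrix of the cyclic convolution. *)
Lemma S16M (m n : int) : S16 m -> S16 n -> S16 (m * n).
Proof.
move=> [a _ <-] [b _ <-]; exists (fun i => \sum_l a (i - l) * b l) => //.
rewrite /D16 -det_mulmx; congr (\det _); apply/matrixP => i j; rewrite !mxE.
rewrite [RHS](reindex_inj (addIr j)) /=.
by apply: eq_bigr => l _; rewrite !mxE addrK opprD addrAC addrA.
Qed.

(** * Congruences between the factors *)

(** Congruence to plus or minus 3 modulo 8; for odd [x] it amounts to [x ^ 2 = 9] modulo 16. *)
Definition pm3 (x : int) : bool := ((x %% 8)%Z == 3) || ((x %% 8)%Z == 5).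

Lemma mod2_split (x : int) : exists (k : int) (b : bool), x = 2 * k + b%:Z.
Proof. by exists (x %/ 2)%Z, (~~ (2 %| x)%Z); lia. Qed.

Lemma mod4_split (x : int) : exists (k : int) (b d : bool),
  x = 4 * k + (b%:Z + 2 * d%:Z).
Proof.
have [k [b ->]] := mod2_split x; have [l [d ->]] := mod2_split k.
by exists l, b, d; ring.
Qed.

Lemma modz_shift (d k y x : int) : x = d * k + y -> (x %% d)%Z = (y %% d)%Z.
Proof. by move->; rewrite mulrC modzMDl. Qed.

(** One of [e_0], [e_2] is odd and the other even, so modulo 8 [e_0 ^ 2 - e_2 ^ 2] is 1 or -1, plus
    4 exactly when [e_0 e_2 = 2] modulo 4; and [2 e_1 e_3] contributes another 4 exactly when
    [e_1 e_3 = 2] modulo 4. *)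
Lemma pm3_gauss (e : nat -> int) :
    ~~ (2 %| e 0%N + e 2%N)%Z -> ~~ (2 %| e 1%N + e 3%N)%Z ->
  pm3 (gauss_re e) = (e 0%N * e 2%N + e 1%N * e 3%N == 2 %[mod 4])%Z.
Proof.
rewrite /pm3 /gauss_re.
move: (e 0%N) (e 1%N) (e 2%N) (e 3%N) => e0 e1 e2 e3.
have [k0 [b0 [d0 ->]]] := mod4_split e0; have [k1 [b1 [d1 ->]]] := mod4_split e1.
have [k2 [b2 [d2 ->]]] := mod4_split e2; have [k3 [b3 [d3 ->]]] := mod4_split e3.
move=> h h'; have {}h : b0 (+) b2 by clear -h; lia.
have {}h' : b1 (+) b3 by clear -h'; lia.
set r0 := b0%:Z + _; set r1 := b1%:Z + _; set r2 := b2%:Z + _; set r3 := b3%:Z + _.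
rewrite (@modz_shift 8 (2 * k0 ^+ 2 + k0 * r0 - 2 * k2 ^+ 2 - k2 * r2
  + 4 * k1 * k3 + k1 * r3 + k3 * r1) (r0 ^+ 2 - r2 ^+ 2 + 2 * r1 * r3)); last by ring.
rewrite (@modz_shift 4 (4 * k0 * k2 + k0 * r2 + k2 * r0 + 4 * k1 * k3 + k1 * r3
  + k3 * r1) (r0 * r2 + r1 * r3)); last by ring.
rewrite {}/r0 {}/r1 {}/r2 {}/r3.
by case: b0 b2 b1 b3 d0 d1 d2 d3 h h' => [] [] // [] [] // [] [] [] [].
Qed.

(** The coordinates consist of squares and doubled products, so modulo 4 they depend only on the
    parities of the entries. *)
Lemma relnorm16_shift (k r : nat -> int) (i : nat) : exists t : int,
  relnorm16 (fun j => 2 * k j + r j) i = 4 * t + relnorm16 r i.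
Proof.
pose sq i := k i ^+ 2 + k i * r i.
pose pr i j := 2 * k i * k j + k i * r j + k j * r i.
exists (nth 0 [:: sq 0 - sq 4 - pr 2 6 + pr 1 7 + pr 3 5;
  pr 0 2 - pr 4 6 - sq 1 + sq 5 + pr 3 7;
  pr 0 4 + sq 2 - sq 6 - pr 1 3 + pr 5 7; pr 0 6 + pr 2 4 - pr 1 5 - sq 3 + sq 7] i).
rewrite /relnorm16; case: i => [|[|[|[|i]]]] /=; last by rewrite nth_nil.
all: by rewrite /sq /pr; ring.
Qed.

(** This is the criterion of [pm3_gauss] for [relnorm16 c]. Hypotheses and conclusion depend only on
    the parities of [c], which leaves 256 cases. *)
Lemma relnorm16_mod4 (c : nat -> int) :
    ~~ (2 %| c 0%N + c 2%N + (c 4%N + c 6%N))%Z ->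
    ~~ (2 %| c 1%N + c 3%N + (c 5%N + c 7%N))%Z ->
    ~~ (2 %| c 0%N * c 6%N + c 2%N * c 4%N + (c 1%N * c 7%N + c 3%N * c 5%N))%Z ->
  let G := relnorm16 c in
  (G 0%N * G 2%N + G 1%N * G 3%N = 2 %[mod 4])%Z.
Proof.
pose k i := (c i %/ 2)%Z; pose b i := ~~ (2 %| c i)%Z; pose r i : int := b i.
have -> : c = fun j => 2 * k j + r j.
  by apply: boolp.funext => i; rewrite /k /r /b; lia.
clearbody k b => h h' /=.
have {h} : b 0%N (+) b 2%N (+) (b 4%N (+) b 6%N) by rewrite /r in h; clear -h; lia.
have {h'} : b 1%N (+) b 3%N (+) (b 5%N (+) b 7%N) by rewrite /r in h'; clear -h'; lia.
have [t0 ->] := relnorm16_shift k r 0; have [t1 ->] := relnorm16_shift k r 1.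
have [t2 ->] := relnorm16_shift k r 2; have [t3 ->] := relnorm16_shift k r 3.
set x0 := relnorm16 r 0; set x1 := relnorm16 r 1.
set x2 := relnorm16 r 2; set x3 := relnorm16 r 3.
rewrite (@modz_shift 4 (4 * t0 * t2 + t0 * x2 + t2 * x0
    + 4 * t1 * t3 + t1 * x3 + t3 * x1) (x0 * x2 + x1 * x3)); last by ring.
pose pr i j := 2 * k i * k j + k i * r j + k j * r i.
have -> : (2 * k 0%N + r 0%N) * (2 * k 6%N + r 6%N)
    + (2 * k 2%N + r 2%N) * (2 * k 4%N + r 4%N)
    + ((2 * k 1%N + r 1%N) * (2 * k 7%N + r 7%N)
    + (2 * k 3%N + r 3%N) * (2 * k 5%N + r 5%N))
  = (pr 0 6 + pr 2 4 + (pr 1 7 + pr 3 5)) * 2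
    + (r 0%N * r 6%N + r 2%N * r 4%N + (r 1%N * r 7%N + r 3%N * r 5%N)).
  by rewrite /pr; ring.
rewrite rpredDl ?dvdz_mull // {}/x0 {}/x1 {}/x2 {}/x3 /relnorm16 /r /=.
move: (b 0%N) (b 1%N) (b 2%N) (b 3%N) (b 4%N) (b 5%N) (b 6%N) (b 7%N).
by do 8!case.
Qed.

Lemma dvdz_shift (d k y x : int) : x = d * k + y -> (d %| x)%Z = (d %| y)%Z.
Proof. by move->; rewrite rpredDl // dvdz_mulr. Qed.

Lemma Euclid_dvdzM (p : nat) (m n : int) : prime p ->
  (p %| m * n)%Z = (p %| m)%Z || (p %| n)%Z.
Proof. by move=> pp; rewrite !dvdzE abszM Euclid_dvdM. Qed.

Lemma dvdz_sqrX (d x : int) : (d %| x)%Z -> (d ^+ 2 %| x ^+ 2)%Z.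
Proof. by move=> dx; rewrite !expr2 dvdz_mul. Qed.

Lemma dvd2_sqrD (x y : int) : (2 %| x ^+ 2 + y ^+ 2)%Z = (2 %| x + y)%Z.
Proof.
have [k [b ->]] := mod2_split x; have [l [d ->]] := mod2_split y.
by case: b d => [] []; lia.
Qed.

Lemma dvd2_sqrB (x y : int) : (2 %| x ^+ 2 - y ^+ 2)%Z = (2 %| x + y)%Z.
Proof. by rewrite -dvd2_sqrD; lia. Qed.

Lemma dvd2_gauss_re (e : nat -> int) :
  (2 %| gauss_re e)%Z = (2 %| e 0%N + e 2%N)%Z.
Proof. by rewrite -dvd2_sqrB /gauss_re; lia. Qed.

Lemma dvd2_gauss_im (e : nat -> int) :
  (2 %| gauss_im e)%Z = (2 %| e 1%N + e 3%N)%Z.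
Proof. by rewrite -dvd2_sqrB /gauss_im; lia. Qed.

Lemma dvd2_relnorm16_02 (c : nat -> int) :
  (2 %| relnorm16 c 0 + relnorm16 c 2)%Z = (2 %| c 0%N + c 2%N + (c 4%N + c 6%N))%Z.
Proof.
have -> : (c 0%N + c 2%N + (c 4%N + c 6%N) = c 0%N + c 4%N + (c 2%N + c 6%N)) by ring.
rewrite -[RHS]dvd2_sqrD; apply: (@dvdz_shift 2 (- 2 * c 2%N * c 6%N
  + c 1%N * c 7%N + c 3%N * c 5%N + c 5%N * c 7%N - c 1%N * c 3%N
  - c 4%N ^+ 2 - c 6%N ^+ 2)).
rewrite /relnorm16 /=; ring.
Qed.

Lemma dvd2_relnorm16_13 (c : nat -> int) :
  (2 %| relnorm16 c 1 + relnorm16 c 3)%Z = (2 %| c 1%N + c 3%N + (c 5%N + c 7%N))%Z.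
Proof.
have -> : (c 1%N + c 3%N + (c 5%N + c 7%N) = c 1%N + c 5%N + (c 3%N + c 7%N)) by ring.
rewrite -[RHS]dvd2_sqrD; apply: (@dvdz_shift 2 (c 0%N * c 2%N - c 4%N * c 6%N
  + c 0%N * c 6%N + c 2%N * c 4%N - 2 * c 1%N * c 5%N
  - c 1%N ^+ 2 - c 3%N ^+ 2)).
rewrite /relnorm16 /=; ring.
Qed.

Lemma dvd2_mul (x y : int) : ~~ (2 %| x + y)%Z -> (2 %| x * y)%Z.
Proof.
move=> oxy; have /orP[] : (2 %| x)%Z || (2 %| y)%Z by lia.
  exact: dvdz_mulr.
exact: dvdz_mull.
Qed.

Lemma sqr_mod16 (x : int) : ~~ (2 %| x)%Z ->
  (x ^+ 2 = (if pm3 x then 9 else 1) %[mod 16])%Z.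
Proof.
rewrite /pm3 => ox; have : x = 8 * (x %/ 8)%Z + (x %% 8)%Z by lia.
have : [|| (x %% 8)%Z == 1, (x %% 8)%Z == 3, (x %% 8)%Z == 5 | (x %% 8)%Z == 7].
  by lia.
move: (x %/ 8)%Z (x %% 8)%Z => k r hr ->.
rewrite (@modz_shift 16 (4 * k ^+ 2 + k * r) (r ^+ 2)); last by ring.
by case/or4P: hr => /eqP->.
Qed.

Lemma det16_even (a : nat -> int) : (2 %| det16 a)%Z -> ~~ (128 %| det16 a)%Z ->
  exists x y m : int, [/\ ~~ (2 %| x)%Z, ~~ (2 %| y)%Z, pm3 x || pm3 y
    & det16 a = 32 * (x ^+ 2 + y ^+ 2) * m].
Proof.
rewrite /det16.
set c := fold_sub 8 a; set b := fold_add 8 a.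
set e := fold_sub 4 b; set w := fold_add 4 b.
set g := fold_sub 2 w; set h := fold_add 2 w.
have h01 : h 0%N = w 0%N + w 2%N /\ h 1%N = w 1%N + w 3%N by [].
have g01 : g 0%N = w 0%N - w 2%N /\ g 1%N = w 1%N - w 3%N by [].
have we i : w i = e i + 2 * b (i + 4)%N by rewrite /w /e /fold_add /fold_sub; ring.
have [wb0 wb1 wb2 wb3] : [/\ w 0%N = b 0%N + b 4%N, w 1%N = b 1%N + b 5%N,
  w 2%N = b 2%N + b 6%N & w 3%N = b 3%N + b 7%N] by [].
have bc i : b i = c i + 2 * a (i + 8)%N by rewrite /b /c /fold_add /fold_sub; ring.
have F4 : (2 %| g 0%N ^+ 2 + g 1%N ^+ 2)%Z = (2 %| h 0%N + h 1%N)%Z.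
  by rewrite dvd2_sqrD; lia.
have re8 : (2 %| gauss_re e)%Z = (2 %| h 0%N)%Z.
  by rewrite dvd2_gauss_re; move: (we 0%N) (we 2%N); lia.
have im8 : (2 %| gauss_im e)%Z = (2 %| h 1%N)%Z.
  by rewrite dvd2_gauss_im; move: (we 1%N) (we 3%N); lia.
have re16 : (2 %| gauss_re (relnorm16 c))%Z = (2 %| h 0%N)%Z.
  rewrite dvd2_gauss_re dvd2_relnorm16_02.
  by move: wb0 wb2 (bc 0%N) (bc 2%N) (bc 4%N) (bc 6%N); clear -h01; lia.
have im16 : (2 %| gauss_im (relnorm16 c))%Z = (2 %| h 1%N)%Z.
  rewrite dvd2_gauss_im dvd2_relnorm16_13.
  by move: wb1 wb3 (bc 1%N) (bc 3%N) (bc 5%N) (bc 7%N); clear -h01; lia.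
(* Modulo 16, [h_0 ^ 2 + h_1 ^ 2 = 10] and [g_0 ^ 2 + g_1 ^ 2 = 2]; the difference 8 is
   [4 (w_0 w_2 + w_1 w_3)]. *)
have q_even : ~~ (2 %| h 0%N)%Z -> ~~ (2 %| h 1%N)%Z ->
    ~~ pm3 (g 0%N) -> ~~ pm3 (g 1%N) -> (h 0%N ^+ 2 - h 1%N ^+ 2 = 8 %[mod 16])%Z ->
  (w 0%N * w 2%N + w 1%N * w 3%N = 2 %[mod 4])%Z.
  move=> oh0 oh1 g0 g1; have og0 : ~~ (2 %| g 0%N)%Z by clear -oh0 h01 g01; lia.
  have og1 : ~~ (2 %| g 1%N)%Z by clear -oh1 h01 g01; lia.
  move: (sqr_mod16 oh0) (sqr_mod16 oh1) (sqr_mod16 og0) (sqr_mod16 og1).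
  rewrite (negPf g0) (negPf g1).
  have : h 0%N ^+ 2 + h 1%N ^+ 2 - g 0%N ^+ 2 - g 1%N ^+ 2
    = 4 * (w 0%N * w 2%N + w 1%N * w 3%N).
    by case: h01 g01 => -> -> [-> ->]; ring.
  clear; case: (pm3 _) (pm3 _) => [] []; lia.
have q8 : ~~ (2 %| h 0%N)%Z -> ~~ (2 %| h 1%N)%Z -> ~~ pm3 (gauss_re e) ->
    (4 %| e 0%N * e 2%N + e 1%N * e 3%N)%Z.
  rewrite -re8 -im8 dvd2_gauss_re dvd2_gauss_im => o02 o13.
  rewrite (pm3_gauss o02 o13).
  have := (dvd2_mul o02, dvd2_mul o13).
  by case; clear; lia.
(* The quadratic expressions in [w] and in [e] differ by twice the one in [b] that [relnorm16_mod4]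
   requires to be odd, and [b = c] modulo 2. *)
have q16 : ~~ (2 %| h 0%N)%Z -> ~~ (2 %| h 1%N)%Z ->
    (w 0%N * w 2%N + w 1%N * w 3%N = 2 %[mod 4])%Z ->
    (4 %| e 0%N * e 2%N + e 1%N * e 3%N)%Z -> pm3 (gauss_re (relnorm16 c)).
  rewrite -re16 -im16 dvd2_gauss_re dvd2_gauss_im => o02 o13 qw qe.
  rewrite (pm3_gauss o02 o13).
  apply/eqP/relnorm16_mod4; rewrite -?dvd2_relnorm16_02 -?dvd2_relnorm16_13 //.
  have -> : (2 %| c 0%N * c 6%N + c 2%N * c 4%N + (c 1%N * c 7%N + c 3%N * c 5%N))%Z
      = (2 %| b 0%N * b 6%N + b 2%N * b 4%N + (b 1%N * b 7%N + b 3%N * b 5%N))%Z.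
    rewrite !bc; clear; move: (a _) (a _) (a _) (a _) (a _) (a _) (a _) (a _).
    by move: c => *; lia.
  have : w 0%N * w 2%N + w 1%N * w 3%N - (e 0%N * e 2%N + e 1%N * e 3%N)
      = 2 * (b 0%N * b 6%N + b 2%N * b 4%N + (b 1%N * b 7%N + b 3%N * b 5%N)).
    by rewrite /w /e /fold_add /fold_sub /=; ring.
  by move: qw qe; clear; lia.
move=> evD ndvD.
have N8 : (2 %| norm8 e)%Z = (2 %| h 0%N + h 1%N)%Z.
  by rewrite dvd2_sqrD; move: re8 im8; clear; lia.
have N16 : (2 %| norm8 (relnorm16 c))%Z = (2 %| h 0%N + h 1%N)%Z.
  by rewrite dvd2_sqrD; move: re16 im16; clear; lia.
have eh : (2 %| h 0%N + h 1%N)%Z.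
  move: evD; rewrite !(@Euclid_dvdzM 2) // dvd2_sqrB F4 N8 N16.
  by rewrite !orbb.
(* If [h_0], and hence [h_1], were even, each of the four factors would be divisible by 4 and the
   determinant by 256. *)
have oh0 : ~~ (2 %| h 0%N)%Z.
  apply: contraNN ndvD => eh0.
  have eh1 : (2 %| h 1%N)%Z by clear -eh eh0; lia.
  have eg0 : (2 %| g 0%N)%Z by clear -eh0 h01 g01; lia.
  have eg1 : (2 %| g 1%N)%Z by clear -eh1 h01 g01; lia.
  apply: (@dvdz_trans (2 ^+ 2 * 2 ^+ 2 * 2 ^+ 2 * 2 ^+ 2)) => //.
  apply: dvdz_mul; [apply: dvdz_mul; [apply: dvdz_mul|]|].
  - by apply: rpredB; apply: dvdz_sqrX.
  - by apply: rpredD; apply: dvdz_sqrX.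
  - by apply: rpredD; apply: dvdz_sqrX; rewrite ?re8 ?im8.
  - by apply: rpredD; apply: dvdz_sqrX; rewrite ?re16 ?im16.
have oh1 : ~~ (2 %| h 1%N)%Z by clear -eh oh0; lia.
move: evD ndvD F4 N8 N16; rewrite /norm8 eh.
have := sqr_mod16 oh0; have := sqr_mod16 oh1.
set x1 := gauss_re e; set y1 := gauss_im e.
set x2 := gauss_re (relnorm16 c); set y2 := gauss_im (relnorm16 c).
move=> s1 s0 _ ndvD /dvdzP[u Eu] /dvdzP[v Ev] /dvdzP[t Et].
have [k Ek] : exists k, h 0%N ^+ 2 - h 1%N ^+ 2 = 8 * k.
  exists ((h 0%N ^+ 2 - h 1%N ^+ 2) %/ 8)%Z; move: s1 s0; clear.
  by case: (pm3 _) (pm3 _) => [] []; lia.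
(* The other three factors are even, so an even [k] would make the determinant divisible by 128. *)
have hmod : (h 0%N ^+ 2 - h 1%N ^+ 2 = 8 %[mod 16])%Z.
  suff ok : ~~ (2 %| k)%Z by rewrite Ek; clear -ok; lia.
  apply: contraNN ndvD => /dvdzP[l El]; apply/dvdzP.
  by exists (l * u * v * t); rewrite Ek El Eu Ev Et; ring.
have [g3|] := boolP (pm3 (g 0%N) || pm3 (g 1%N)).
  exists (g 0%N), (g 1%N), (k * v * t); split=> //.
  - by clear -oh0 h01 g01; lia.
  - by clear -oh1 h01 g01; lia.
  by rewrite Ek Ev Et; ring.
rewrite negb_or => /andP[ng0 ng1].
have [e3|ne3] := boolP (pm3 x1).
  exists x1, y1, (k * u * t); rewrite /x1 /y1 re8 im8 e3; split=> //.
  by rewrite Ek Eu Et; ring.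
have c3 := q16 oh0 oh1 (q_even oh0 oh1 ng0 ng1 hmod) (q8 oh0 oh1 ne3).
exists x2, y2, (k * u * v); rewrite /x2 /y2 re16 im16 c3; split=> //.
by rewrite Ek Eu Ev; ring.
Qed.

(** * Prime divisors of sums of two squares *)

Lemma prime_neq_exp (n k : nat) : (1 < k)%N -> ~~ prime (n ^ k).
Proof.
move=> k1; apply/negP => pr; have := logn_prime (n ^ k) pr.
by rewrite eqxx lognX => /eqP; rewrite muln_eq1 => /andP[/eqP k1']; rewrite k1' in k1.
Qed.

(** Pigeonhole: more than [p] vectors have entries in [0..n], so two of them share the value of the
    linear form modulo [p], and their difference works. *)
Lemma thue (p k : nat) (c : 'I_k -> int) : prime p -> (1 < k)%N ->
  exists v : 'I_k -> int, [/\ exists i, v i != 0,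
    forall i, (`|v i| ^ k < p)%N & (p %| \sum_i c i * v i)%Z].
Proof.
move=> pp k1; have p_gt0 := prime_gt0 pp.
have [|n ltn minn] := @ex_minnP (fun n => p < n.+1 ^ k)%N.
  by exists p; rewrite -{1}[p.+1]expn1 leq_pexp2l // ltnW.
(* Minimality of [n] gives [n ^ k <= p], and a prime is not a perfect [k]-th power. *)
have nk : (n ^ k < p)%N.
  rewrite ltn_neqAle; apply/andP; split.
    by apply: contraTneq pp => <-; apply: prime_neq_exp.
  case: n minn {ltn} => [|n] minn; first by rewrite exp0n // ltnW.
  by rewrite leqNgt; apply/negP => /minn; rewrite ltnn.
pose lin (f : {ffun 'I_k -> 'I_n.+1}) := \sum_i c i * f i.
have lin_lt f : (`|(lin f %% p)%Z| < p)%N.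
  have := ltz_pmod (lin f) (p_gt0 : 0 < p :> int).
  by have := modz_ge0 (lin f) (lt0r_neq0 (p_gt0 : 0 < p :> int)); lia.
have /injectivePn[f [g fg /(congr1 val) /= eq_fg]] :
    ~~ injectiveb (fun f => Ordinal (lin_lt f)).
  apply/negP => /injectiveP /leq_card.
  by rewrite card_ffun !card_ord leqNgt ltn.
exists (fun i => (f i : int) - (g i : int)); split.
- have [i fgi] : exists i, f i != g i.
    apply/existsP; apply: contraNT fg => /existsPn eqfg.
    by apply/eqP/ffunP => i; apply/eqP; have := eqfg i; rewrite negbK.
  by exists i; rewrite subr_eq0 eqz_nat.
- move=> i; apply: leq_ltn_trans nk; rewrite leq_exp2r; last exact: ltnW.
  by have := ltn_ord (f i); have := ltn_ord (g i); lia.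
- under eq_bigr do rewrite mulrBr.
  rewrite sumrB -eqz_mod_dvd; apply/eqP.
  have := modz_ge0 (lin f) (lt0r_neq0 (p_gt0 : 0 < p :> int)).
  have := modz_ge0 (lin g) (lt0r_neq0 (p_gt0 : 0 < p :> int)).
  by rewrite /lin in eq_fg *; lia.
Qed.

Lemma thue2 (p : nat) (x y : int) : prime p -> exists a b : int,
  [/\ (a != 0) || (b != 0), a ^+ 2 < p, b ^+ 2 < p & (p %| a * x + b * y)%Z].
Proof.
move=> pp; have [v [[i vi] vlt vdvd]] :=
  thue (fun i : 'I_2 => if i == 0 :> nat then x else y) pp isT.
exists (v 0), (v 1); have sq j : v j ^+ 2 < p.
  by have := vlt j; rewrite -abszX; lia.
split=> //.
  by case: i vi => -[|[|//]] h vi; apply/orP; [left|right];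
    by apply: contraNneq vi => <-; apply/eqP; congr v; apply/val_inj.
by move: vdvd; rewrite !big_ord_recr big_ord0 /= add0r mulrC [y * _]mulrC;
  congr (_ %| v _ * _ + v _ * _)%Z; apply/val_inj.
Qed.

(** Thue's lemma gives a short [(a, b)] orthogonal to [(x, y)] modulo [p]. Then [p] divides
    [a ^ 2 + b ^ 2], which lies strictly between 0 and [2 p]. *)
Lemma prime_dvd_sum_sqr (p : nat) (x y : int) : prime p ->
    (p %| x ^+ 2 + y ^+ 2)%Z -> ~~ (p %| x)%Z ->
  exists a b : int, a ^+ 2 + b ^+ 2 = p /\ (p %| a * x + b * y)%Z.
Proof.
move=> pp pxy px; have [a [b [ab0 a2 b2 pab]]] := thue2 x y pp.
exists a, b; split=> //.
have : (p %| y * y * (a ^+ 2 + b ^+ 2))%Z.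
  have -> : y * y * (a ^+ 2 + b ^+ 2)
      = a ^+ 2 * (x ^+ 2 + y ^+ 2) - (a * x + b * y) * (a * x - b * y) by ring.
  by rewrite rpredB // ?(dvdz_mull _ pxy) ?(dvdz_mulr _ pab).
rewrite !Euclid_dvdzM // orbb => /orP[py|/dvdzP[k Ek]].
  case/negP: px; have : (p %| x * x)%Z.
    rewrite (_ : x * x = x ^+ 2 + y ^+ 2 - y * y); last by ring.
    by rewrite rpredB // dvdz_mulr.
  by rewrite Euclid_dvdzM // orbb.
have p0 : 0 < p%:Z by have := prime_gt0 pp; lia.
have ab_gt0 : 0 < a ^+ 2 + b ^+ 2.
  by rewrite lt0r addr_ge0 ?paddr_eq0 ?sqr_ge0 // !sqrf_eq0 negb_and ab0.
have k0 : 0 < k by rewrite -(pmulr_lgt0 _ p0) -Ek.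
have k2 : k < 2 by rewrite -(ltr_pM2r p0) -Ek mulr_natl; apply: ltrD.
have k1 : k = 1 by clear -k0 k2; lia.
by rewrite Ek k1 mul1r.
Qed.

Lemma pm3_modz (x y : int) : (x = y %[mod 8])%Z -> pm3 x = pm3 y.
Proof. by rewrite /pm3 => ->. Qed.

Definition residues8 : seq int := [seq i%:Z | i <- iota 0 8].

Lemma mod8_split (x : int) : exists k r : int, x = 8 * k + r /\ r \in residues8.
Proof.
exists (x %/ 8)%Z, (x %% 8)%Z; split; first by lia.
apply/mapP; exists `|(x %% 8)%Z|%N; last by lia.
by rewrite mem_iota; lia.
Qed.

(* The odd Gaussian integers [a + bi] with [a ^ 2 + b ^ 2 = 1 mod 8] and
   [a + b = 1] or [-1 mod 8] form a subgroup modulo 8, which moreover preserves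
   the class of [(1 + i) * odd] whose coordinates are both [1] or [-1 mod 8]. *)
Lemma pm3_gaussM (a b x y : int) :
    (a ^+ 2 + b ^+ 2 = 1 %[mod 8])%Z -> ~~ pm3 (a + b) ->
    ~~ (2 %| x)%Z -> ~~ (2 %| y)%Z ->
  pm3 (a * x - b * y) || pm3 (b * x + a * y) -> pm3 x || pm3 y.
Proof.
have [k [r [-> hr]]] := mod8_split a; have [l [s [-> hs]]] := mod8_split b.
have [m [t [-> ht]]] := mod8_split x; have [n [u [-> hu]]] := mod8_split y.
rewrite (@modz_shift 8 (8 * k ^+ 2 + 2 * k * r + 8 * l ^+ 2 + 2 * l * s)
  (r ^+ 2 + s ^+ 2)); last by ring.
rewrite (@pm3_modz _ (r + s)); last by apply: (@modz_shift 8 (k + l)); ring.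
rewrite (@dvdz_shift 2 (4 * m) t); last by ring.
rewrite (@dvdz_shift 2 (4 * n) u (8 * n + u)); last by ring.
rewrite (@pm3_modz (_ - _) (r * t - s * u)); last first.
  by apply: (@modz_shift 8 (8 * k * m + k * t + r * m - 8 * l * n - l * u - s * n)); ring.
rewrite (@pm3_modz (_ * _ + _ * _) (s * t + r * u)); last first.
  by apply: (@modz_shift 8 (8 * l * m + l * t + s * m + 8 * k * n + k * u + r * n)); ring.
rewrite (@pm3_modz (8 * m + t) t); last exact: modz_shift.
rewrite (@pm3_modz (8 * n + u) u); last exact: modz_shift.
move=> /eqP h1 h2 h3 h4; apply/implyP; move: h1 h2 h3 h4.
(* All quantities are now expressed by residues, and the 4096 quadruples are checked by
   computation. *)
have /allP/(_ r hr)/allP/(_ s hs)/allP/(_ t ht)/allP/(_ u hu) :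
  all (fun r => all (fun s => all (fun t => all (fun u : int =>
    (r ^+ 2 + s ^+ 2 == 1 %[mod 8])%Z && ~~ pm3 (r + s) && ~~ (2 %| t)%Z
      && ~~ (2 %| u)%Z ==> 
    (pm3 (r * t - s * u) || pm3 (s * t + r * u) ==> pm3 t || pm3 u))
    residues8) residues8) residues8) residues8 by vm_compute.
by move=> /implyP h h1 h2 h3 h4; apply: h; rewrite h1 h2 h3.
Qed.

(** Gathers the three families of [d] for which the theorem lists the multiples of [64 d]. *)
Inductive admissible : int -> Prop :=
| Admissible1 (p : nat) of primes_sum_sq_1mod8 p : admissible p
| Admissible5 (p : nat) of prime p & p = 5 %[mod 8] : admissible p
| Admissible3 (p : nat) of prime p & p = 3 %[mod 8] : admissible (p%:Z ^+ 2).

Lemma sum_sqr_mod8 (a b : int) : ~~ (2 %| a ^+ 2 + b ^+ 2)%Z ->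
  (a ^+ 2 + b ^+ 2 = 1 %[mod 8])%Z \/ (a ^+ 2 + b ^+ 2 = 5 %[mod 8])%Z.
Proof.
have [k [r [-> hr]]] := mod8_split a; have [l [s [-> hs]]] := mod8_split b.
rewrite (@modz_shift 8 (8 * k ^+ 2 + 2 * k * r + 8 * l ^+ 2 + 2 * l * s)
  (r ^+ 2 + s ^+ 2)); last by ring.
rewrite (@dvdz_shift 2 (4 * (8 * k ^+ 2 + 2 * k * r + 8 * l ^+ 2 + 2 * l * s))
  (r ^+ 2 + s ^+ 2)); last by ring.
have /allP/(_ r hr)/allP/(_ s hs) /implyP h :
  all (fun r => all (fun s : int => ~~ (2 %| r ^+ 2 + s ^+ 2)%Z ==>
    (r ^+ 2 + s ^+ 2 == 1 %[mod 8])%Z || (r ^+ 2 + s ^+ 2 == 5 %[mod 8])%Z)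
    residues8) residues8 by vm_compute.
by move=> /h /orP[] /eqP; [left|right].
Qed.

(** Descent on [x ^ 2 + y ^ 2]: an odd prime divisor either yields an admissible divisor or can be
    divided out of [x + i y] while keeping the hypotheses. The descent cannot reach [x, y = 1] or
    [-1], where [pm3] fails. *)
Lemma admissible_dvd_sum_sqr (x y : int) : ~~ (2 %| x)%Z -> ~~ (2 %| y)%Z ->
  pm3 x || pm3 y -> exists2 d, admissible d & (d %| x ^+ 2 + y ^+ 2)%Z.
Proof.
have [n] := ubnP `|(x ^+ 2 + y ^+ 2)%R|%N.
elim: n x y => // n IH x y ltn ox oy xy3.
set N := x ^+ 2 + y ^+ 2 in ltn *.
have N_gt0 : 0 < N.
  by rewrite lt0r addr_ge0 ?paddr_eq0 ?sqr_ge0 // !sqrf_eq0; lia.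
have [M NM] : exists M, N = 2 * M.
  by exists (N %/ 2)%Z; move: (dvd2_sqrD x y); rewrite -/N; lia.
have oM : ~~ (2 %| M)%Z.
  move: (sqr_mod16 ox) (sqr_mod16 oy) NM; rewrite /N; clear.
  by case: (pm3 _) (pm3 _) => [] []; lia.
have M_neq1 : M != 1.
  apply: contraTneq xy3 => M1; move: NM; rewrite M1 /N => E2.
  have x2 : x ^+ 2 > 0 by rewrite lt0r sqr_ge0 sqrf_eq0 andbT; clear -ox; lia.
  have y2 : y ^+ 2 > 0 by rewrite lt0r sqr_ge0 sqrf_eq0 andbT; clear -oy; lia.
  have /eqP : x ^+ 2 = 1 by clear -x2 y2 E2; lia.
  have /eqP : y ^+ 2 = 1 by clear -x2 y2 E2; lia.
  by rewrite !sqrf_eq1 => /orP[] /eqP-> /orP[] /eqP->.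
pose p := pdiv `|M|%N.
have pp : prime p by rewrite pdiv_prime //; clear -N_gt0 NM M_neq1; lia.
have pN : (p %| N)%Z by rewrite NM dvdz_mull // dvdzE pdiv_dvd.
have op : odd p.
  have : (p %| M)%Z by rewrite dvdzE pdiv_dvd.
  case: (even_prime pp) => [->|//]; by rewrite (negPf oM).
have p_gt0 : 0 < p%:Z by have := prime_gt0 pp; clear; lia.
have descent q x' y' : 1 < q -> N = q * (x' ^+ 2 + y' ^+ 2) ->
    ~~ (2 %| x')%Z -> ~~ (2 %| y')%Z -> pm3 x' || pm3 y' ->
  exists2 d, admissible d & (d %| N)%Z.
  move=> q1 EN ox' oy' xy'; have [|d hd dvd] := IH x' y' _ ox' oy' xy'.
    rewrite -ltnS; apply: leq_trans ltn; rewrite ltnS EN abszM ltn_Pmull ?absz_gt0 //.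
      by clear -q1; lia.
    by apply: contraTneq N_gt0 => E0; rewrite EN E0 mulr0.
  by exists d => //; rewrite EN dvdz_mull.
have [px|px] := boolP (p %| x)%Z.
  have /dvdzP[y' Ey] : (p %| y)%Z.
    have : (p %| N - x * x)%Z by rewrite rpredB // dvdz_mulr.
    by rewrite /N -expr2 addrC addKr expr2 Euclid_dvdzM // orbb.
  have /dvdzP[x' Ex] := px.
  have EN : N = p%:Z ^+ 2 * (x' ^+ 2 + y' ^+ 2) by rewrite /N Ex Ey; ring.
  have ox' : ~~ (2 %| x')%Z by apply: contraNN ox => h; rewrite Ex dvdz_mulr.
  have oy' : ~~ (2 %| y')%Z by apply: contraNN oy => h; rewrite Ey dvdz_mulr.
  have p2 : 1 < p%:Z ^+ 2 by rewrite exprn_egt1 // ltz_nat prime_gt1.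
  have [p3|p3] := eqVneq (p %% 8)%N 3.
    by exists (p%:Z ^+ 2); [apply: Admissible3 | rewrite EN dvdz_mulr].
  have [p5|p5] := eqVneq (p %% 8)%N 5.
    by exists p%:Z => //; apply: Admissible5.
  (* Here [p] is 1 or -1 modulo 8, so multiplication by [p] preserves [pm3]. *)
  apply: (descent _ x' y' p2 EN) => //.
  have : (p = 1 %[mod 8])%N \/ (p = 7 %[mod 8])%N by clear -op p3 p5; lia.
  move: xy3; rewrite Ex Ey; clear => xy3 hp.
  have pm3p (z : int) : pm3 (z * p) = pm3 z.
    have -> : p%:Z = 8 * (p %/ 8)%N%:Z + (p %% 8)%N%:Z by clear; lia.
    rewrite mulrDr (@pm3_modz (_ + _) (z * (p %% 8)%N%:Z)); last first.
      by apply: (@modz_shift 8 (z * (p %/ 8)%N%:Z)); ring.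
    by case: hp => ->; rewrite /pm3; lia.
  by rewrite !pm3p in xy3.
have [a [b [Ep /dvdzP[x' Ex]]]] := prime_dvd_sum_sqr pp pN px.
(* With both divisibilities, [x + i y = (a + i b) (x' + i y')] in Z[i]. *)
have /dvdzP[y' Ey] : (p %| a * y - b * x)%Z.
  have : (p %| (a * y - b * x) * (a * y - b * x))%Z.
    rewrite (_ : _ * _ = p%:Z * N - (a * x + b * y) * (a * x + b * y)).
      by rewrite rpredB ?dvdz_mulr // Ex dvdz_mull.
    by rewrite -Ep /N; ring.
  by rewrite Euclid_dvdzM // orbb.
have xE : x = a * x' - b * y'.
  apply: (mulIf (lt0r_neq0 p_gt0)); rewrite mulrBl -!mulrA -Ex -Ey -Ep; ring.
have yE : y = b * x' + a * y'.
  apply: (mulIf (lt0r_neq0 p_gt0)); rewrite mulrDl -!mulrA -Ex -Ey -Ep; ring.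
have op' : ~~ (2 %| a ^+ 2 + b ^+ 2)%Z by rewrite Ep; clear -op; lia.
have [/eqP p1|/eqP p5] := sum_sqr_mod8 op'; last first.
  by exists p%:Z => //; apply: Admissible5 => //; move: p5; rewrite Ep; clear; lia.
have [ab3|ab3] := boolP (pm3 (a + b)).
  exists p%:Z => //; apply: Admissible1; split=> //; split.
    by move: p1; rewrite Ep; clear; lia.
  by exists a, b; rewrite Ep; split=> //; move: ab3; rewrite /pm3; clear; lia.
have oab : ~~ (2 %| a + b)%Z by rewrite -dvd2_sqrD.
have oxy' : ~~ (2 %| x')%Z && ~~ (2 %| y')%Z.
  move: ox oy oab; rewrite xE yE; clear.
  have [k [c ->]] := mod2_split a; have [l [d ->]] := mod2_split b.
  by case: c d => [] []; lia.
case/andP: oxy' => ox' oy'.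
apply: (descent p x' y') => //.
- by rewrite ltz_nat prime_gt1.
- by rewrite /N xE yE -Ep; ring.
- by apply: pm3_gaussM ab3 ox' oy' _; [apply/eqP | rewrite -xE -yE].
Qed.

(** * Constructions *)

(* Adds multiples of [x ^ 16 - 1] divided by [x - 1], [x ^ 2 + 1], [x ^ 4 + 1],
   which changes the values at 1, at [i] and at [zeta_8] respectively. *)
Definition perturb (a : nat -> int) (k : int) (t s : nat -> int) (i : nat) : int :=
  a i + (k + (-1) ^+ i./2 * t (i %% 2)%N + (-1) ^+ (i %/ 4) * s (i %% 4)%N).

(** Each of the three added terms vanishes at all 16th roots of unity outside its own class, so the
    first three factors are adjusted independently and the last is unchanged. *)
Lemma det16_perturb (a : nat -> int) (k : int) (t s : nat -> int) :
  let c := fold_sub 8 a in let b := fold_add 8 a in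
  let e := fold_sub 4 b in let w := fold_add 4 b in
  let g := fold_sub 2 w in let h := fold_add 2 w in
  det16 (perturb a k t s) = ((h 0%N + 8 * k) ^+ 2 - (h 1%N + 8 * k) ^+ 2)
    * ((g 0%N + 8 * t 0%N) ^+ 2 + (g 1%N + 8 * t 1%N) ^+ 2)
    * norm8 (fun i => e i + 4 * s i) * norm8 (relnorm16 c).
Proof.
move=> c b e w g h; rewrite /det16 /perturb.
set T := fun i : nat => (-1) ^+ i./2 * t (i %% 2)%N.
set S := fun i : nat => (-1) ^+ (i %/ 4) * s (i %% 4)%N.
(* These periods and sign changes decide which foldings cancel [T] and [S] and which double them. *)
have T2 i : T (i + 2)%N = - T i.
  rewrite /T modnDr (_ : (i + 2)./2 = 1 + i./2)%N; last by lia.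
  by rewrite exprD mulN1r mulNr.
have S4 i : S (i + 4)%N = - S i.
  rewrite /S modnDr (_ : (i + 4) %/ 4 = 1 + i %/ 4)%N; last by lia.
  by rewrite exprD mulN1r mulNr.
have T4 i : T (i + 4)%N = T i by rewrite (addnA i 2 2) !T2 opprK.
have S8 i : S (i + 8)%N = S i by rewrite (addnA i 4 4) !S4 opprK.
have T8 i : T (i + 8)%N = T i by rewrite (addnA i 4 4) !T4.
have -> : fold_sub 8 (fun i => a i + (k + T i + S i)) = c.
  by apply: boolp.funext => i; rewrite /fold_sub T8 S8 /c /fold_sub; ring.
have -> : fold_add 8 (fun i => a i + (k + T i + S i))
    = fun i => b i + 2 * (k + T i + S i).
  by apply: boolp.funext => i; rewrite /fold_add T8 S8 /b /fold_add; ring.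
have -> : fold_sub 4 (fun i => b i + 2 * (k + T i + S i)) = fun i => e i + 4 * S i.
  by apply: boolp.funext => i; rewrite /fold_sub T4 S4 /e /fold_sub; ring.
have -> : fold_add 4 (fun i => b i + 2 * (k + T i + S i)) = fun i => w i + 4 * (k + T i).
  by apply: boolp.funext => i; rewrite /fold_add T4 S4 /w /fold_add; ring.
have -> : fold_sub 2 (fun i => w i + 4 * (k + T i)) = fun i => g i + 8 * T i.
  by apply: boolp.funext => i; rewrite /fold_sub T2 /g /fold_sub; ring.
have -> : fold_add 2 (fun i => w i + 4 * (k + T i)) = fun i => h i + 8 * k.
  by apply: boolp.funext => i; rewrite /fold_add T2 /h /fold_add; ring.
by rewrite /T /S /norm8 /gauss_re /gauss_im /= !mul1r.
Qed.

Definition mod_x8 (l : seq int) : nat -> int := fold_add 8 (nth 0 l).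
Definition mod_x4 (l : seq int) : nat -> int := fold_add 4 (mod_x8 l).

(** For a concrete list [l] the premises are settled by computation, leaving [k], [t], [s] free. *)
Lemma S16_perturb (l : seq int) (k : int) (t s : nat -> int) (h0 h1 g0 g1 f : int) :
  [/\ fold_add 2 (mod_x4 l) 0 = h0, fold_add 2 (mod_x4 l) 1 = h1,
    fold_sub 2 (mod_x4 l) 0 = g0, fold_sub 2 (mod_x4 l) 1 = g1
    & norm8 (relnorm16 (fold_sub 8 (nth 0 l))) = f] ->
  S16 (((h0 + 8 * k) ^+ 2 - (h1 + 8 * k) ^+ 2)
    * ((g0 + 8 * t 0%N) ^+ 2 + (g1 + 8 * t 1%N) ^+ 2)
    * norm8 (fun i => fold_sub 4 (mod_x8 l) i + 4 * s i) * f).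
Proof.
move=> [<- <- <- <- <-]; apply/S16P.
by exists (perturb (nth 0 l) k t s); rewrite det16_perturb.
Qed.

Lemma norm8_ext (e e' : nat -> int) : e 0%N = e' 0%N -> e 1%N = e' 1%N ->
  e 2%N = e' 2%N -> e 3%N = e' 3%N -> norm8 e = norm8 e'.
Proof. by rewrite /norm8 /gauss_re /gauss_im => -> -> -> ->. Qed.

(** For odd [r], [1 + x + ... + x ^ (r - 1)] is [r] at 1 and a unit at the other 16th roots of
    unity; the perturbation by [k] changes the value at 1 to [r + 16 k]. *)
Lemma S16_odd (n : int) : ~~ (2 %| n)%Z -> S16 n.
Proof.
move=> on; pose r := `|(n %% 16)%Z|%N; pose k := (n %/ 16)%Z.
have -> : n = 16 * k + r%:Z by rewrite /k /r; lia.
have hr : r \in [:: 1; 3; 5; 7; 9; 11; 13; 15]%N by rewrite !inE /r; lia.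
pose chk (s : nat) := let l := nseq s 1 in
  [&& fold_add 2 (mod_x4 l) 0 == s./2%:Z + 1, fold_add 2 (mod_x4 l) 1 == s./2,
    fold_sub 2 (mod_x4 l) 0 ^+ 2 + fold_sub 2 (mod_x4 l) 1 ^+ 2 == 1,
    norm8 (fun i => fold_sub 4 (mod_x8 l) i + 4 * 0) == 1,
    norm8 (relnorm16 (fold_sub 8 (nth 0 (nseq s 1)))) == 1 :> int
  & s == (s./2 + s./2 + 1)%N].
have /allP/(_ r hr) : all chk [:: 1; 3; 5; 7; 9; 11; 13; 15]%N by vm_compute.
case/and5P => /eqP h0 /eqP h1 /eqP g01 /eqP e1 /andP[/eqP c1 /eqP Er].
have := S16_perturb k (fun=> 0) (fun=> 0) (And5 h0 h1 erefl erefl c1).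
rewrite e1 !mulr0 !addr0 g01 !mulr1; congr S16.
by rewrite [in RHS]Er; move: r./2 => q; clear; rewrite !PoszD; ring.
Qed.

(** The polynomial [1 - x] is 0 at 1 and 2 at -1, and its three norms are 2; the perturbation makes
    the value at 1 equal to [16 m]. *)
Lemma S16_256 (m : int) : S16 (256 * m).
Proof.
have := @S16_perturb [:: 1; -1] m (fun=> 0) (fun=> 0) 1 (-1) 1 (-1) 2.
move=> /(_ (And5 erefl erefl erefl erefl erefl)) /=.
rewrite (_ : norm8 _ = 2); last by vm_compute.
by congr S16; ring.
Qed.

Lemma S16_128 : S16 128.
Proof.
(* The four factors of this witness are 16, 2, 2, 2. *)
by apply/S16P; exists (nth 0 [:: 0; 0; 0; 0; 0; 0; 1; 0; 1; 0; 1; 1; 1; 1; 1; 1]);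
  vm_compute.
Qed.

Lemma S16_128M (m : int) : S16 (128 * m).
Proof.
have [/dvdzP[k ->]|om] := boolP (2 %| m)%Z.
  by rewrite (_ : _ * _ = 256 * k); [apply: S16_256 | ring].
by apply: S16M (S16_128) _; apply: S16_odd.
Qed.

Lemma S16_sum_sqr (x y : int) : ~~ (2 %| x)%Z -> ~~ (2 %| y)%Z ->
  pm3 x (+) pm3 y -> S16 (32 * (x ^+ 2 + y ^+ 2)).
Proof.
wlog : x y / pm3 x.
  move=> W ox oy xy; have [x3|nx3] := boolP (pm3 x); first exact: W.
  rewrite addrC; apply: W => //; rewrite ?(addbC (pm3 y)) //.
  by move: xy; rewrite (negPf nx3).
move=> x3 ox oy; rewrite x3 /= => y3.
have [t Ex] : exists t, x ^+ 2 = (-3 + 8 * t) ^+ 2.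
  move: x3; rewrite /pm3 => /orP[] /eqP x8.
    by exists (- (x %/ 8)%Z); rewrite -sqrrN; congr (_ ^+ 2); lia.
  by exists ((x %/ 8)%Z + 1); congr (_ ^+ 2); lia.
have [u Ey] : exists u, y ^+ 2 = (-1 + 8 * u) ^+ 2.
  have /orP[] : ((y %% 8)%Z == 1) || ((y %% 8)%Z == 7).
    by move: y3 oy; rewrite /pm3; clear; lia.
    by move=> /eqP y8; exists (- (y %/ 8)%Z); rewrite -sqrrN; congr (_ ^+ 2); lia.
  by move=> /eqP y8; exists ((y %/ 8)%Z + 1); congr (_ ^+ 2); lia.
(* The factors of this list are 8, 10, 2, 2, with value [-3 - i] at [i]; [t] and [u] move its
   coordinates to [x] and [y] up to sign. *)
have := @S16_perturb [:: 0; 0; 0; 0; 0; 0; 1; 0; 0; 0; 1; 0; 0; 0; 1; 1] 0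
  (nth 0 [:: t; u]) (fun=> 0) 3 1 (-3) (-1) 2.
move=> /(_ (And5 erefl erefl erefl erefl erefl)) /=.
rewrite (_ : norm8 _ = 2); last by vm_compute.
by rewrite -Ex -Ey; congr S16; ring.
Qed.

(** Perturbation changes the coordinates at [zeta_8] by multiples of 4. Up to sign, [e] lies in one
    of four classes modulo 4, each with a base polynomial whose other factors are 8, 2, 2. *)
Lemma S16_norm8_ooee (e : nat -> int) :
    ~~ (2 %| e 0%N)%Z -> ~~ (2 %| e 1%N)%Z -> (2 %| e 2%N)%Z -> (2 %| e 3%N)%Z ->
    (e 0%N * e 2%N + e 1%N * e 3%N = 2 %[mod 4])%Z ->
  S16 (32 * norm8 e).
Proof.
wlog e0 : e / (e 0%N = 1 %[mod 4])%Z => [W o0 o1 e2 e3 es|o0 o1 e2 e3 es].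
  have [e0|e0] := eqVneq (e 0%N %% 4)%Z 1; first exact: W.
  have -> : norm8 e = norm8 (fun i => - e i).
    by rewrite /norm8 /gauss_re /gauss_im; ring.
  by apply: W; rewrite ?rpredN ?mulrNN //; clear -o0 e0; lia.
have {es} es : (e 2%N + e 3%N = 2 %[mod 4])%Z.
  have {e0}/dvdzP[k0 E0] : (4 %| e 0%N - 1)%Z by clear -e0; lia.
  have /dvdzP[k2 E2] := e2; have /dvdzP[k3 E3] := e3.
  have [k1 [d1 E1]] := mod2_split (e 1%N).
  move: es o1; rewrite -(subrK 1 (e 0%N)) E0 E1 E2 E3; clear.
  by case: d1; lia.
have base l (r1 r2 r3 : int) :
    [&& fold_add 2 (mod_x4 l) 0 == -3, fold_add 2 (mod_x4 l) 1 == -1,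
      fold_sub 2 (mod_x4 l) 0 == 1, fold_sub 2 (mod_x4 l) 1 == -1,
      norm8 (relnorm16 (fold_sub 8 (nth 0 l))) == 2,
      fold_sub 4 (mod_x8 l) 0 == 1, fold_sub 4 (mod_x8 l) 1 == r1,
      fold_sub 4 (mod_x8 l) 2 == r2 & fold_sub 4 (mod_x8 l) 3 == r3] ->
    [&& (e 1%N == r1 %[mod 4])%Z, (e 2%N == r2 %[mod 4])%Z & (e 3%N == r3 %[mod 4])%Z] ->
    S16 (32 * norm8 e).
  case/and5P=> /eqP h0 /eqP h1 /eqP g0 /eqP g1.
  case/and5P=> /eqP f /eqP l0 /eqP l1 /eqP l2 /eqP l3.
  case/and3P => /eqP e1 /eqP {}e2 /eqP {}e3.
  pose s i := ((e i - fold_sub 4 (mod_x8 l) i) %/ 4)%Z.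
  have := S16_perturb 0 (fun=> 0) s (And5 h0 h1 g0 g1 f).
  rewrite (@norm8_ext _ e) /s ?l0 ?l1 ?l2 ?l3; try by clear -e0 e1 e2 e3; lia.
  by congr S16; ring.
have : [|| (e 1%N == 1 %[mod 4])%Z | (e 1%N == -1 %[mod 4])%Z] by clear -o1; lia.
have : ((e 2%N == 2 %[mod 4])%Z && (e 3%N == 0 %[mod 4])%Z)
    || ((e 2%N == 0 %[mod 4])%Z && (e 3%N == 2 %[mod 4])%Z) by clear -e2 e3 es; lia.
case/orP=> /andP[e2' e3'] /orP[] e1'.
- by apply: (base [:: 0; 0; 0; 0; -1; -1; -1; 0; 0; 0; 0; 0; 0; 0; -1] 1 2 0);
    rewrite ?e1' ?e2' ?e3'.
- by apply: (base [:: 0; -1; 0; 0; -1; 0; -1; 0; 0; 0; 0; 0; 0; 0; -1] (-1) 2 0);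
    rewrite ?e1' ?e2' ?e3'.
- by apply: (base [:: 0; 0; -1; 0; -1; -1; -1; -1; 0; 0; 0; 1] 1 0 2);
    rewrite ?e1' ?e2' ?e3'.
- by apply: (base [:: 0; -1; -1; 0; -1; 0; -1; 0; 0; 0; 0; 1; 0; 0; 0; -1] (-1) 0 2);
    rewrite ?e1' ?e2' ?e3'.
Qed.

(* Multiplication by a primitive eighth root of unity. *)
Definition rot8 (e : nat -> int) : nat -> int := nth 0 [:: - e 3%N; e 0%N; e 1%N; e 2%N].

Lemma norm8_rot8 (e : nat -> int) : norm8 (rot8 e) = norm8 e.
Proof. by rewrite /norm8 /gauss_re /gauss_im /rot8 /=; ring. Qed.

(** A suitable number of rotations by [zeta_8] brings the odd coordinates to positions 0 and 1. *)
Lemma S16_norm8 (e : nat -> int) :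
    ~~ (2 %| gauss_re e)%Z -> ~~ (2 %| gauss_im e)%Z -> pm3 (gauss_re e) ->
  S16 (32 * norm8 e).
Proof.
rewrite dvd2_gauss_re dvd2_gauss_im => o02 o13.
rewrite (pm3_gauss o02 o13) => /eqP.
have ev02 := dvd2_mul o02; have ev13 := dvd2_mul o13.
have [e0|o0] := boolP (2 %| e 0%N)%Z; have [e1|o1] := boolP (2 %| e 1%N)%Z => hs.
- rewrite -norm8_rot8 -norm8_rot8.
  apply: S16_norm8_ooee; rewrite /rot8 /=;
    try by clear -o02 o13 e0 e1 ev02 ev13 hs; lia.
- rewrite -norm8_rot8 -norm8_rot8 -norm8_rot8.
  apply: S16_norm8_ooee; rewrite /rot8 /=;
    try by clear -o02 o13 e0 o1 ev02 ev13 hs; lia.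
- rewrite -norm8_rot8.
  apply: S16_norm8_ooee; rewrite /rot8 /=;
    try by clear -o02 o13 o0 e1 ev02 ev13 hs; lia.
apply: S16_norm8_ooee => //; clear -o02 o13 o0 o1; lia.
Qed.

(** * Representations of primes *)

Lemma intr_Fp_eq0 (p : nat) (n : int) : prime p ->
  (n%:~R == 0 :> 'F_p) = (p %| n)%Z.
Proof.
move=> pp; rewrite dvdzE (dvdn_pcharf (pchar_Fp pp)).
by case: n => n; rewrite ?NegzE ?rmorphN ?oppr_eq0.
Qed.

Lemma Fp_int (p : nat) (z : 'F_p) : prime p -> exists t : int, t%:~R = z.
Proof.
by move=> pp; exists (z : nat)%:Z; rewrite -[RHS]natr_Zp.
Qed.

Lemma Fp_exp_half (p : nat) (z : 'F_p) : prime p -> odd p -> z != 0 ->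
  z ^+ p./2 = 1 \/ z ^+ p./2 = -1.
Proof.
move=> pp op z0; have /eqP : (z ^+ p./2) ^+ 2 = 1.
  apply: (mulfI z0); rewrite mulr1 -exprM -exprS -[RHS]expf_card card_Fp //.
  by congr (_ ^+ _); rewrite -[in RHS](odd_double_half p) op; lia.
by rewrite sqrf_eq1 => /orP[] /eqP ->; [left|right].
Qed.

(** The polynomial [X ^ ((p - 1) / 2) - 1] has too few roots to vanish on all [p - 1] nonzero
    elements. *)
Lemma Fp_nonresidue (p : nat) : prime p -> odd p ->
  exists z : 'F_p, z ^+ p./2 = -1.
Proof.
move=> pp op; have p3 : (2 < p)%N by have := prime_gt1 pp; move: op; clear; lia.
have [/existsP[z /eqP zh]|/existsPn no] := boolP [exists z : 'F_p, z ^+ p./2 == -1].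
  by exists z.
pose rs := [seq z <- enum 'F_p | z != 0].
pose q : {poly 'F_p} := 'X^(p./2) - 1%:P.
have : (size rs < size q)%N.
  apply: max_poly_roots; last by rewrite filter_uniq // enum_uniq.
    by rewrite -size_poly_eq0 /q size_XnsubC //; clear -p3; lia.
  apply/allP => z; rewrite mem_filter => /andP[z0 _].
  rewrite /root /q !hornerE subr_eq0.
  by have [/eqP//|/eqP zh] := Fp_exp_half pp op z0; rewrite (negPf (no z)) in zh.
rewrite /q size_XnsubC; last by clear -p3; lia.
have -> : size rs = p.-1.
  have := cardC1 (0 : 'F_p); rewrite card_Fp // => <-.
  by rewrite /rs enumT cardE /enum_mem; congr (size _); apply: eq_filter.
by clear -p3 op; lia.
Qed.

Lemma root_neg1_mod (p k : nat) : prime p -> odd p -> (k %| p./2)%N ->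
  exists t : int, (p %| t ^+ k + 1)%Z.
Proof.
move=> pp op /dvdnP[j Ej]; have [z zh] := Fp_nonresidue pp op.
have [t Et] := Fp_int (z ^+ j) pp; exists t.
by rewrite -intr_Fp_eq0 // rmorphD rmorphXn /= Et -exprM -Ej zh addNr.
Qed.

(** Irrationality of the square root of 2, by parity of 2-adic valuations. *)
Lemma sqr_neq_double (a b : int) : a ^+ 2 = 2 * b ^+ 2 -> b = 0.
Proof.
move=> E; apply/eqP; rewrite -absz_eq0; apply: contra_eqT (congr1 absz E).
rewrite -lt0n abszM !abszX => b0; apply/eqP => /(congr1 (logn 2)).
by rewrite lognM ?expn_gt0 ?b0 // !lognX (_ : logn 2 `|2| = 1)%N //; lia.
Qed.

Lemma sqrB2_mod8 (a b : int) : (2 * a ^+ 2 - b ^+ 2 <> 3 %[mod 8])%Z.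
Proof.
have [k [r [-> hr]]] := mod8_split a; have [l [s [-> hs]]] := mod8_split b.
rewrite (@modz_shift 8 (16 * k ^+ 2 + 4 * k * r - 8 * l ^+ 2 - 2 * l * s)
  (2 * r ^+ 2 - s ^+ 2)); last by ring.
have /allP/(_ r hr)/allP/(_ s hs) h :
  all (fun r => all (fun s : int => (2 * r ^+ 2 - s ^+ 2 != 3 %[mod 8])%Z)
    residues8) residues8 by vm_compute.
exact/eqP.
Qed.

(** Otherwise Thue's lemma gives [2 a ^ 2 - b ^ 2 = k p] with [k] equal to 0 or 1; the first
    contradicts irrationality, the second fails modulo 8. *)
Lemma two_nonresidue (p : nat) (s : int) : prime p -> (p = 3 %[mod 8])%N ->
  ~~ (p %| s ^+ 2 - 2)%Z.
Proof.
move=> pp p3; apply/negP => ps.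
have [a [b [ab0 a2 b2 pab]]] := thue2 s 1 pp.
have /dvdzP[k Ek] : (p %| 2 * a ^+ 2 - b ^+ 2)%Z.
  have -> : 2 * a ^+ 2 - b ^+ 2
      = (a * s + b * 1) * (a * s - b * 1) - a ^+ 2 * (s ^+ 2 - 2) by ring.
  by rewrite rpredB // ?(dvdz_mulr _ pab) ?(dvdz_mull _ ps).
have p0 : 0 < p%:Z by have := prime_gt0 pp; clear; lia.
have k2 : k < 2.
  rewrite -(ltr_pM2r p0) -Ek.
  by move: a2 (sqr_ge0 b); clear; lia.
have k1 : -1 < k.
  rewrite -(ltr_pM2r p0) -Ek.
  by move: b2 (sqr_ge0 a); clear; lia.
have /orP[/eqP k0|/eqP {}k1] : (k == 0) || (k == 1) by clear -k1 k2; lia.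
  have /eqP : b ^+ 2 = 2 * a ^+ 2 by move: Ek; rewrite k0 mul0r; clear; lia.
  move=> /eqP E; have a0 := sqr_neq_double E; move: E ab0.
  by rewrite a0 expr0n mulr0 eqxx => /eqP; rewrite sqrf_eq0 => ->.
by apply: (@sqrB2_mod8 a b); rewrite Ek k1 mul1r; clear -p3; lia.
Qed.

(** Both -1 and 2 are nonresidues, so -2 is a residue; a residue [z] has the square root
    [z ^ ((p + 1) / 4)]. *)
Lemma neg2_residue (p : nat) : prime p -> (p = 3 %[mod 8])%N ->
  exists t : int, (p %| t ^+ 2 + 2)%Z.
Proof.
move=> pp p3; have op : odd p by clear -p3; lia.
have oh : odd p./2 by clear -p3; lia.
have sq (z : 'F_p) : z ^+ p./2 = 1 -> exists t : int, t%:~R ^+ 2 = z.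
  move=> zh; have [t Et] := Fp_int (z ^+ (p./2).+1./2) pp; exists t.
  rewrite Et -exprM (_ : (_ * _)%N = (p./2).+1) ?exprS ?zh ?mulr1 //.
  by clear -oh; lia.
have two0 : 2%:~R != 0 :> 'F_p.
  by rewrite intr_Fp_eq0 //; apply/negP; rewrite dvdzE => /dvdn_leq; clear -p3; lia.
have [h|h] := Fp_exp_half pp op two0.
  have [s Es] := sq _ h; case/negP: (two_nonresidue s pp p3).
  by rewrite -intr_Fp_eq0 // rmorphB rmorphXn /= Es subrr.
have [|t Et] := sq (- 2%:~R); first by rewrite exprNn h -signr_odd oh mulrNN mulr1.
by exists t; rewrite -intr_Fp_eq0 // rmorphD rmorphXn /= Et addNr.
Qed.

(** Thue's lemma gives [b ^ 2 + 2 a ^ 2] equal to [p] or [2 p]; in the latter case [b] is even and 2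
    cancels. *)
Lemma prime_3mod8_form (p : nat) : prime p -> (p = 3 %[mod 8])%N ->
  exists a b : int, p%:Z = a ^+ 2 + 2 * b ^+ 2.
Proof.
move=> pp p3; have [t pt] := neg2_residue pp p3.
have [a [b [ab0 a2 b2 pab]]] := thue2 t 1 pp.
have /dvdzP[k Ek] : (p %| b ^+ 2 + 2 * a ^+ 2)%Z.
  have -> : b ^+ 2 + 2 * a ^+ 2
      = a ^+ 2 * (t ^+ 2 + 2) - (a * t + b * 1) * (a * t - b * 1) by ring.
  by rewrite rpredB // ?(dvdz_mulr _ pab) ?(dvdz_mull _ pt).
have p0 : 0 < p%:Z by have := prime_gt0 pp; clear; lia.
have k3 : k < 3.
  by rewrite -(ltr_pM2r p0) -Ek; move: a2 b2; clear; lia.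
have k0 : 0 < k.
  rewrite -(pmulr_lgt0 _ p0) -Ek; move: ab0; rewrite -(sqrf_eq0 a) -(sqrf_eq0 b).
  by move: (sqr_ge0 a) (sqr_ge0 b); clear; lia.
have /orP[/eqP k1|/eqP k2] : (k == 1) || (k == 2) by clear -k0 k3; lia.
  by exists b, a; rewrite Ek k1 mul1r.
have /dvdzP[c Ec] : (2 %| b)%Z.
  have : (2 %| b * b)%Z by move: Ek; rewrite k2; clear; lia.
  by rewrite (@Euclid_dvdzM 2) // orbb.
by exists a, c; move: Ek; rewrite k2 Ec; clear; lia.
Qed.

Lemma prime_5mod8_form (p : nat) : prime p -> (p = 5 %[mod 8])%N ->
  exists a b : int, p%:Z = a ^+ 2 + b ^+ 2.
Proof.
move=> pp p5; have [t pt] : exists t : int, (p %| t ^+ 2 + 1)%Z.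
  by apply: root_neg1_mod => //; clear -p5; lia.
have [||a [b [<- _]]] := @prime_dvd_sum_sqr p 1 t pp; last by exists a, b.
  by rewrite expr1n addrC.
by rewrite dvdz1; have := prime_gt1 pp; clear; lia.
Qed.

(** * Arithmetic of Z[zeta_8] and primes congruent to 1 modulo 8 *)

Implicit Types (e : nat -> int) (t : int).

Definition mul8 (a b : nat -> int) : nat -> int := nth 0
  [:: a 0%N * b 0%N - a 1%N * b 3%N - a 2%N * b 2%N - a 3%N * b 1%N;
      a 0%N * b 1%N + a 1%N * b 0%N - a 2%N * b 3%N - a 3%N * b 2%N;
      a 0%N * b 2%N + a 1%N * b 1%N + a 2%N * b 0%N - a 3%N * b 3%N;
      a 0%N * b 3%N + a 1%N * b 2%N + a 2%N * b 1%N + a 3%N * b 0%N].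

(* The product of the conjugates of [e] other than [e]. *)
Definition conj8 e : nat -> int := let x := gauss_re e in let y := gauss_im e in
  nth 0 [:: e 0%N * x + e 2%N * y; - e 1%N * x - e 3%N * y;
            e 2%N * x - e 0%N * y; - e 3%N * x + e 1%N * y].

(** When [p] divides [t ^ 4 + 1], reduction modulo [p] makes this the ring morphism from Z[zeta_8]
    to F_p sending [zeta_8] to [t]; its kernel is a prime ideal above [p]. *)
Definition eval8 t e : int :=
  e 0%N + e 1%N * t + e 2%N * t ^+ 2 + e 3%N * t ^+ 3.

Lemma norm8M (a b : nat -> int) : norm8 (mul8 a b) = norm8 a * norm8 b.
Proof.
rewrite /norm8.
have -> : gauss_re (mul8 a b) = gauss_re a * gauss_re b - gauss_im a * gauss_im b.
  by rewrite /gauss_re /gauss_im /mul8 /=; ring.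
have -> : gauss_im (mul8 a b) = gauss_re a * gauss_im b + gauss_im a * gauss_re b.
  by rewrite /gauss_re /gauss_im /mul8 /=; ring.
by ring.
Qed.

Lemma norm8_conj8 e : norm8 (conj8 e) = norm8 e ^+ 3.
Proof.
(* The conjugate under [zeta_8 -> - zeta_8] is multiplied by the complex conjugate of the relative
   norm of [e]. *)
have -> : norm8 (conj8 e) = norm8 (fun i => (-1) ^+ i * e i)
    * norm8 (nth 0 [:: gauss_re e; 0; - gauss_im e]).
  rewrite -norm8M; apply: norm8_ext; rewrite /conj8 /mul8 /=;
  move: (gauss_re e) (gauss_im e) => x y; ring.
have -> : norm8 (fun i => (-1) ^+ i * e i) = norm8 e.
  by rewrite /norm8 /gauss_re /gauss_im; ring.
have -> x y : norm8 (nth 0 [:: x; 0; - y]) = (x ^+ 2 + y ^+ 2) ^+ 2.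
  by rewrite /norm8 /gauss_re /gauss_im /=; ring.
by rewrite -/(norm8 e) -exprS.
Qed.

Lemma mul_conj8 e (i : nat) : mul8 e (conj8 e) i = nth 0 [:: norm8 e] i.
Proof.
case: i => [|[|[|[|i]]]] /=; rewrite /mul8 /conj8 /norm8 /gauss_re /gauss_im /=;
  rewrite ?nth_nil //; ring.
Qed.

Lemma mul8A (a b c : nat -> int) : mul8 a (mul8 b c) =1 mul8 (mul8 a b) c.
Proof.
by case=> [|[|[|[|i]]]] /=; rewrite /mul8 /= ?nth_nil //; ring.
Qed.

Lemma eval8M t (a b : nat -> int) :
  (t ^+ 4 + 1 %| eval8 t a * eval8 t b - eval8 t (mul8 a b))%Z.
Proof.
apply/dvdzP; exists (a 1%N * b 3%N + a 2%N * b 2%N + a 3%N * b 1%N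
  + (a 2%N * b 3%N + a 3%N * b 2%N) * t + a 3%N * b 3%N * t ^+ 2).
by rewrite /eval8 /mul8 /=; ring.
Qed.

Lemma norm8_ge0 e : 0 <= norm8 e.
Proof. by rewrite addr_ge0 ?sqr_ge0. Qed.

(* The norm computed through the real quadratic subfield Q(sqrt 2). *)
Lemma norm8_real e : norm8 e = (e 0%N ^+ 2 + e 1%N ^+ 2 + e 2%N ^+ 2 + e 3%N ^+ 2) ^+ 2
  - 2 * (e 0%N * e 1%N + e 1%N * e 2%N + e 2%N * e 3%N - e 0%N * e 3%N) ^+ 2.
Proof. by rewrite /norm8 /gauss_re /gauss_im; ring. Qed.

Lemma norm8_eq0 e : norm8 e = 0 -> [/\ e 0%N = 0, e 1%N = 0, e 2%N = 0 & e 3%N = 0].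
Proof.
rewrite norm8_real => /eqP; rewrite subr_eq0 => /eqP E.
have /eqP : e 0%N ^+ 2 + e 1%N ^+ 2 + e 2%N ^+ 2 + e 3%N ^+ 2 = 0.
  by apply/eqP; rewrite -sqrf_eq0 E (sqr_neq_double E) expr0n mulr0.
by rewrite !paddr_eq0 ?addr_ge0 ?sqr_ge0 // !sqrf_eq0 => /andP[/andP[/andP[]]]
  /eqP-> /eqP-> /eqP-> /eqP->.
Qed.

Lemma norm8_round (s : nat -> int) (N : int) : 0 < N ->
  (forall i, - N <= s i < N) -> norm8 s < 16 * N ^+ 4.
Proof.
move=> N0 sN; have sq i : s i ^+ 2 <= N ^+ 2.
  have : 0 <= (N - s i) * (N + s i) by apply: mulr_ge0; have := sN i; clear; lia.
  by clear; lia.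
(* Only at this corner does the bound [(sum of s_i ^ 2) ^ 2 <= 16 N ^ 4] fail to be strict; the norm
   there is [8 N ^ 4]. *)
have [/and4P[/eqP s0 /eqP s1 /eqP s2 /eqP s3]|nex] :=
    boolP [&& s 0%N == - N, s 1%N == - N, s 2%N == - N & s 3%N == - N].
  rewrite /norm8 /gauss_re /gauss_im s0 s1 s2 s3.
  have -> : ((- N) ^+ 2 - (- N) ^+ 2 + 2 * - N * - N) ^+ 2
    + (2 * - N * - N - (- N) ^+ 2 + (- N) ^+ 2) ^+ 2 = 8 * N ^+ 4 by ring.
  by rewrite ltr_pM2r ?exprn_gt0.
have lt_sq i : s i != - N -> s i ^+ 2 < N ^+ 2.
  move=> ne; have : 0 < (N - s i) * (N + s i).
    by apply: mulr_gt0; move: (sN i) ne; clear; lia.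
  by clear; lia.
set Q := s 0%N ^+ 2 + s 1%N ^+ 2 + s 2%N ^+ 2 + s 3%N ^+ 2.
have Q_lt : Q < 4 * N ^+ 2.
  have := (sq 0%N, sq 1%N, sq 2%N, sq 3%N) => -[[[q0 q1] q2] q3].
  move: nex; rewrite !negb_and => /or4P[] /lt_sq;
    by move: q0 q1 q2 q3; rewrite /Q; clear; lia.
have Q_ge0 : 0 <= Q by rewrite !addr_ge0 ?sqr_ge0.
apply: (@le_lt_trans _ _ (Q ^+ 2)).
  by rewrite norm8_real -/Q gerBl mulr_ge0 ?sqr_ge0.
have -> : 16 * N ^+ 4 = (4 * N ^+ 2) ^+ 2 by ring.
by rewrite ltr_pXn2r ?nnegrE // mulr_ge0 ?sqr_ge0.
Qed.

(* Nearest-point rounding shows that Z[zeta_8] is Euclidean for the norm: the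
   remainder of [p] by an element of norm less than [p ^ 2] lies in the same
   prime ideal above [p]; once it vanishes, the divisor has norm [p]. *)
Lemma norm8_descent (p : nat) t e : prime p -> (p %| t ^+ 4 + 1)%Z ->
    (p %| eval8 t e)%Z -> 0 < norm8 e -> norm8 e < p%:Z ^+ 2 ->
  exists a : nat -> int, norm8 a = p%:Z.
Proof.
move=> pp pt; have [n] := ubnP `|norm8 e|%N.
elim: n e => // n IH e ltn pe; set N := norm8 e => N_gt0 N_lt.
have evM a b : (p %| eval8 t a * eval8 t b - eval8 t (mul8 a b))%Z.
  exact: dvdz_trans pt (eval8M t a b).
have pN : (p %| N)%Z.
  have := evM e (conj8 e); rewrite [eval8 t (mul8 _ _)]/eval8 !mul_conj8 /=.
  rewrite !mul0r !addr0 -/N => h.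
  by rewrite -(subKr (eval8 t e * eval8 t (conj8 e)) N) rpredB // dvdz_mulr.
(* As [1 / e = conj8 e / N], this rounds the coordinates of [p / e] to nearest integers; [r] is the
   remainder [p - k e]. *)
pose k i := ((2 * p%:Z * conj8 e i + N) %/ (2 * N))%Z.
pose one : nat -> int := nth 0 [:: 1].
pose r i := p%:Z * one i - mul8 k e i.
have mulkc i : (i < 4)%N -> mul8 (mul8 k e) (conj8 e) i = N * k i.
  rewrite -mul8A {1}/mul8 !mul_conj8.
  by case: i => [|[|[|[|i]]]] //= _; ring.
have rE i : (i < 4)%N -> mul8 r (conj8 e) i = p%:Z * conj8 e i - N * k i.
  move=> i4; rewrite -mulkc // /r; move: (mul8 k e) (conj8 e) => m c.
  by case: i i4 => [|[|[|[|i]]]] //= _; rewrite /mul8 /one /=; ring.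
have r_norm : norm8 r * N ^+ 3 < N ^+ 4.
  have -> : N ^+ 3 = norm8 (conj8 e) by rewrite norm8_conj8.
  rewrite -norm8M (@norm8_ext _ (fun i => p%:Z * conj8 e i - N * k i)) ?rE //.
  have := @norm8_round (fun i => 2 * (p%:Z * conj8 e i - N * k i)) N N_gt0.
  have -> : norm8 (fun i => 2 * (p%:Z * conj8 e i - N * k i))
      = 16 * norm8 (fun i => p%:Z * conj8 e i - N * k i).
    by rewrite /norm8 /gauss_re /gauss_im; ring.
  rewrite ltr_pM2l //; apply => i.
  have := divz_eq (2 * p%:Z * conj8 e i + N) (2 * N); rewrite -/(k i).
  have N2 : 0 < 2 * N by clear -N_gt0; lia.
  have := modz_ge0 (2 * p%:Z * conj8 e i + N) (lt0r_neq0 N2).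
  have := ltz_pmod (2 * p%:Z * conj8 e i + N) N2.
  by move: (_ %% _)%Z => z; clear; lia.
have r_lt : norm8 r < N.
  by rewrite -(ltr_pM2r (exprn_gt0 3 N_gt0)) -exprS.
have pr : (p %| eval8 t r)%Z.
  have -> : eval8 t r = p%:Z + (eval8 t k * eval8 t e - eval8 t (mul8 k e))
      - eval8 t k * eval8 t e.
    by rewrite /eval8 /r /one /=; ring.
  apply: rpredB; last exact: dvdz_mull.
  by apply: rpredD; [apply: dvdzz | apply: evM].
have [r0|r_neq0] := eqVneq (norm8 r) 0; last first.
  apply: (IH r) => //; last exact: lt_trans N_lt.
    by move: ltn r_lt (norm8_ge0 r); rewrite -/N; clear; lia.
  by rewrite lt0r r_neq0 norm8_ge0.
have [] := norm8_eq0 r0; rewrite /r /one /= => /eqP r0' r1' r2' r3'.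
(* Now [p = k e], so [N] is a power of [p], divisible by [p] and below [p ^ 2]. *)
have Np : norm8 k * N = p%:Z ^+ 4.
  rewrite /N -norm8M (@norm8_ext _ (nth 0 [:: p%:Z])); last 4 first.
  - by move: r0'; rewrite subr_eq0 mulr1 => /eqP <-.
  - by move: r1'; rewrite /= mulr0; clear; lia.
  - by move: r2'; rewrite /= mulr0; clear; lia.
  - by move: r3'; rewrite /= mulr0; clear; lia.
  by rewrite /norm8 /gauss_re /gauss_im /=; ring.
exists e; rewrite -/N.
have p0 : 0 < p%:Z by have := prime_gt0 pp; clear; lia.
have : (`|N| %| p ^ 4)%N.
  by have /(congr1 absz) := Np; rewrite abszM abszX /= => <-; apply: dvdn_mull.
case/(dvdn_pfactor _ _ pp) => m _ Em.
have {}Em : N = p%:Z ^+ m by rewrite -[N]gez0_abs ?ltW // Em; lia.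
case: m Em => [|[|m]] Em; last 1 first.
- move: N_lt; rewrite Em ltNge => /negP[].
  by apply: ler_weXn2l => //; clear -p0; lia.
- by move: pN; rewrite Em expr0 dvdz1; have := prime_gt1 pp; clear; lia.
- by rewrite Em expr1.
Qed.

(** Thue's lemma in dimension 4 supplies a nonzero element of the prime ideal, of norm below [16 p];
    this is less than [p ^ 2] because [p >= 17], so the descent applies. *)
Lemma prime_1mod8_norm8 (p : nat) : prime p -> (p = 1 %[mod 8])%N ->
  exists a : nat -> int, norm8 a = p%:Z.
Proof.
move=> pp p1; have op : odd p by clear -p1; lia.
have p17 : (16 < p)%N.
  have : p != 9 by apply: contraTneq pp => ->.
  by have := prime_gt1 pp; clear -p1; lia.
have [t pt] : exists t : int, (p %| t ^+ 4 + 1)%Z.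
  by apply: root_neg1_mod => //; clear -p1; lia.
have [v [[i vi] vlt pv]] := thue (fun i : 'I_4 => t ^+ i) pp isT.
pose e (j : nat) := v (inord j).
have sq j : e j ^+ 4 < p%:Z by have := vlt (inord j); rewrite -abszX /e; clear; lia.
have ev (j : 'I_4) : e j = v j by rewrite /e inord_val.
have pe : (p %| eval8 t e)%Z.
  rewrite (_ : eval8 t e = \sum_(j < 4) t ^+ j * e j).
    by under eq_bigr do rewrite ev.
  by rewrite !big_ord_recr big_ord0 /= /eval8; ring.
apply: (norm8_descent pp pt pe).
  rewrite lt0r norm8_ge0 andbT; apply: contraNneq vi => /norm8_eq0[e0 e1 e2 e3].
  by rewrite -ev; case: i => -[|[|[|[|//]]]] h /=; rewrite ?e0 ?e1 ?e2 ?e3.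
have e4 : e 0%N ^+ 4 + e 1%N ^+ 4 + e 2%N ^+ 4 + e 3%N ^+ 4 < 4 * p%:Z.
  by move: (sq 0%N) (sq 1%N) (sq 2%N) (sq 3%N); clear; lia.
have le4 : norm8 e <= 4 * (e 0%N ^+ 4 + e 1%N ^+ 4 + e 2%N ^+ 4 + e 3%N ^+ 4).
  rewrite norm8_real -subr_ge0.
  pose d i j := e i ^+ 2 - e j ^+ 2.
  set P := e 0%N * e 1%N + _ + _ - _.
  rewrite (_ : _ - _ = d 0%N 1%N ^+ 2 + d 0%N 2%N ^+ 2 + d 0%N 3%N ^+ 2
    + d 1%N 2%N ^+ 2 + d 1%N 3%N ^+ 2 + d 2%N 3%N ^+ 2 + 2 * P ^+ 2).
    by rewrite !addr_ge0 ?sqr_ge0 // mulr_ge0 ?sqr_ge0.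
  by rewrite /d; ring.
apply: (le_lt_trans le4); apply: (@lt_trans _ _ (16 * p%:Z)).
  by clear -e4; lia.
by rewrite expr2 ltr_pM2r //; clear -p17; lia.
Qed.

(** By unique factorization in Z[i], [x + i y] is [1 + i] times [a + i b] or its conjugate, up to a
    unit. *)
Lemma prime_sum_sqr_double (p : nat) (a b x y : int) : prime p ->
    a ^+ 2 + b ^+ 2 = p%:Z -> x ^+ 2 + y ^+ 2 = 2 * p%:Z ->
  x ^+ 2 = (a + b) ^+ 2 \/ x ^+ 2 = (a - b) ^+ 2.
Proof.
move=> pp Ep Exy; have p0 : p%:Z != 0 by have := prime_gt0 pp; clear; lia.
have main c : a ^+ 2 + c ^+ 2 = p%:Z -> (p %| a * x + c * y)%Z ->
    x ^+ 2 = (a + c) ^+ 2 \/ x ^+ 2 = (a - c) ^+ 2.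
  move=> Ec /dvdzP[u Eu].
  have /dvdzP[v Ev] : (p %| a * y - c * x)%Z.
    have : (p %| (a * y - c * x) * (a * y - c * x))%Z.
      rewrite (_ : _ * _ = (a ^+ 2 + c ^+ 2) * (x ^+ 2 + y ^+ 2)
        - (a * x + c * y) * (a * x + c * y)); last by ring.
      rewrite Ec; apply: rpredB; first exact: dvdz_mulr.
      by rewrite Eu dvdz_mull // dvdz_mull.
    by rewrite Euclid_dvdzM // orbb.
  have uv : u ^+ 2 + v ^+ 2 = 2.
    apply: (mulIf (expf_neq0 2 p0)); rewrite mulrDl -!exprMn -Eu -Ev.
    apply: (@etrans _ _ ((a ^+ 2 + c ^+ 2) * (x ^+ 2 + y ^+ 2))); first by ring.
    by rewrite Ec Exy; ring.
  have Ex : x = a * u - c * v.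
    by apply: (mulIf p0); rewrite mulrBl -!mulrA -Eu -Ev -Ec; ring.
  have [u1 v1] : u ^+ 2 = 1 /\ v ^+ 2 = 1.
    have nonzero (z : int) : z ^+ 2 != 2.
      by apply/eqP => Ez; have := @sqr_neq_double z 1; rewrite Ez => /(_ erefl).
    have [u0|u0] := eqVneq u 0.
      by have := nonzero v; rewrite -uv u0 expr0n add0r eqxx.
    have [v0|v0] := eqVneq v 0.
      by have := nonzero u; rewrite -uv v0 expr0n addr0 eqxx.
    have : 0 < u ^+ 2 by rewrite lt0r sqr_ge0 sqrf_eq0 u0.
    have : 0 < v ^+ 2 by rewrite lt0r sqr_ge0 sqrf_eq0 v0.
    by move: uv; clear; lia.
  have /eqP := u1; rewrite sqrf_eq1 => /orP[] /eqP Eu1;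
  have /eqP := v1; rewrite sqrf_eq1 => /orP[] /eqP Ev1;
  rewrite Ex Eu1 Ev1; (try by left; ring); by right; ring.
have : (p %| (a * x + b * y) * (a * x - b * y))%Z.
  rewrite (_ : _ * _ = a ^+ 2 * (x ^+ 2 + y ^+ 2) - (a ^+ 2 + b ^+ 2) * y ^+ 2).
    by rewrite Exy Ep; apply: rpredB; [do 2!apply: dvdz_mull | apply: dvdz_mulr].
  by ring.
rewrite Euclid_dvdzM // => /orP[h|h]; first exact: main.
have [||-> | ->] := main (- b); rewrite ?sqrrN ?mulNr ?opprK //; [right|left]; ring.
Qed.

(** * Realization of the even values and conclusion *)

Lemma pm3_sqr (x y : int) : ~~ (2 %| x)%Z -> ~~ (2 %| y)%Z ->
  (x ^+ 2 = y ^+ 2 %[mod 16])%Z -> pm3 x = pm3 y.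
Proof.
move=> ox oy; rewrite !sqr_mod16 //.
by case: (pm3 x) (pm3 y) => [] [].
Qed.

Lemma dvd4_mul (a b : int) : (a ^+ 2 + b ^+ 2 = 1 %[mod 8])%Z -> (4 %| a * b)%Z.
Proof.
have [k [r [-> hr]]] := mod8_split a; have [l [s [-> hs]]] := mod8_split b.
rewrite (@modz_shift 8 (8 * k ^+ 2 + 2 * k * r + 8 * l ^+ 2 + 2 * l * s)
  (r ^+ 2 + s ^+ 2)); last by ring.
rewrite (@dvdz_shift 4 (16 * k * l + 2 * k * s + 2 * l * r) (r * s)); last by ring.
have /allP/(_ r hr)/allP/(_ s hs)/implyP h :
  all (fun r => all (fun s : int => (r ^+ 2 + s ^+ 2 == 1 %[mod 8])%Z
    ==> (4 %| r * s)%Z) residues8) residues8 by vm_compute.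
by move=> /eqP.
Qed.

Lemma S16_admissible (d : int) : admissible d -> S16 (64 * d).
Proof.
case=> p.
- move=> [pp [p1 [a [b [Ep ab]]]]].
  have [f Ef] := prime_1mod8_norm8 pp p1.
  (* Multiplying by [1 - zeta_8], of norm 2, gives norm [2 p]. *)
  pose e := mul8 (nth 0 [:: 1; -1]) f.
  have Ee : norm8 e = 2 * p%:Z by rewrite norm8M Ef.
  have oe : ~~ (2 %| gauss_re e)%Z && ~~ (2 %| gauss_im e)%Z.
    have [k [c Ek]] := mod2_split (gauss_re e).
    have [l [c' El]] := mod2_split (gauss_im e).
    move: Ee; rewrite /norm8 Ek El; clear -p1.
    by case: c c' => [] []; lia.
  have /andP[ore oim] := oe.
  rewrite (_ : 64 * p%:Z = 32 * norm8 e); last by rewrite Ee; ring.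
  apply: S16_norm8 => //.
  have oab : ~~ (2 %| a + b)%Z by case: ab; clear; lia.
  have pm3ab : pm3 (a + b) by case: ab; rewrite /pm3 => ->.
  have ab_even : (4 %| a * b)%Z.
    by apply: dvd4_mul; rewrite -Ep; clear -p1; lia.
  suff -> : pm3 (gauss_re e) = pm3 (a + b) by [].
  apply: pm3_sqr => //.
  (* The squares of [a + b] and [a - b] agree modulo 16 because 4 divides [a b]. *)
  have [->|->] := prime_sum_sqr_double pp (esym Ep) Ee; first by [].
  rewrite (_ : (a - b) ^+ 2 = (a + b) ^+ 2 - 4 * (a * b)); last by ring.
  by clear -ab_even; lia.
- move=> pp p5; have [a [b Ep]] := prime_5mod8_form pp p5.
  have oab : ~~ (2 %| a ^+ 2 + b ^+ 2)%Z by rewrite -Ep; clear -p5; lia.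
  rewrite (_ : 64 * p%:Z = 32 * ((a - b) ^+ 2 + (a + b) ^+ 2)); last by rewrite Ep; ring.
  have o1 : ~~ (2 %| a - b)%Z by move: oab; rewrite dvd2_sqrD; clear; lia.
  have o2 : ~~ (2 %| a + b)%Z by move: oab; rewrite dvd2_sqrD; clear; lia.
  (* The two squares add up to [2 p = 10] modulo 16, so exactly one of them is 9. *)
  apply: S16_sum_sqr => //; move: (sqr_mod16 o1) (sqr_mod16 o2).
  have : (a - b) ^+ 2 + (a + b) ^+ 2 = 2 * p%:Z by rewrite Ep; ring.
  move: (_ ^+ 2) (_ ^+ 2) => x y; clear -p5.
  by case: (pm3 _) (pm3 _) => [] []; lia.
move=> pp p3; have [a [b Ep]] := prime_3mod8_form pp p3.
(* This is [(1 - zeta_8) (a + b (zeta_8 + zeta_8 ^ 3))], where [zeta_8 + zeta_8 ^ 3] is a square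
   root of -2; its relative norm is [p (1 - i)]. *)
pose e : nat -> int := nth 0 [:: a + b; b - a; - b; b].
have re_e : gauss_re e = p%:Z by rewrite Ep /gauss_re /e /=; ring.
have im_e : gauss_im e = - p%:Z by rewrite Ep /gauss_im /e /=; ring.
rewrite (_ : 64 * _ = 32 * norm8 e); last by rewrite /norm8 re_e im_e; ring.
apply: S16_norm8; rewrite ?re_e ?im_e /pm3; clear -p3; lia.
Qed.

Lemma S16_admissibleM (d m : int) : admissible d -> S16 (64 * d * m).
Proof.
move=> hd; have [/dvdzP[k ->]|om] := boolP (2 %| m)%Z.
  by rewrite (_ : _ * _ = 128 * (d * k)); [apply: S16_128M | ring].
by apply: S16M; [apply: S16_admissible | apply: S16_odd].
Qed.

Lemma S16_even (n : int) : S16 n -> (2 %| n)%Z ->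
  (128 %| n)%Z \/ exists2 d, admissible d & exists m, n = 64 * d * m.
Proof.
move=> /S16P[a <-] ev; have [?|nd] := boolP (128 %| det16 a)%Z; first by left.
have [x [y [m [ox oy xy3 ->]]]] := det16_even ev nd; right.
have [d hd dxy] := admissible_dvd_sum_sqr ox oy xy3; exists d => //.
(* Since [d] is odd, both 2 and [d] can be extracted from [x ^ 2 + y ^ 2], turning 32 into
   [64 d]. *)
have od : coprimez 2 d.
  suff : ~~ (2 %| d)%Z by rewrite coprimezE coprime2n; clear; lia.
  case: d / hd {dxy} => p; first by case=> _ [p1 _]; clear -p1; lia.
    by move=> _ p5; clear -p5; lia.
  by move=> _ p3; rewrite expr2 (@Euclid_dvdzM 2) // orbb; clear -p3; lia.
have /dvdzP[k ->] : (2 * d %| x ^+ 2 + y ^+ 2)%Z.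
  by rewrite Gauss_dvdz // dxy andbT dvd2_sqrD; clear -ox oy; lia.
by exists (k * m); ring.
Qed.

Theorem theorem1p1 :
  S16 =
    Zodd
    `|` [set 128 * m | m in [set: int]]
    `|` [set n | exists (p : nat) (m : int),
          primes_sum_sq_1mod8 p /\ n = 64 * p%:Z * m]
    `|` [set n | exists (p : nat) (m : int),
          prime p /\ p = 5 %[mod 8] /\ n = 64 * p%:Z * m]
    `|` [set n | exists (p : nat) (m : int),
          prime p /\ p = 3 %[mod 8] /\ n = 64 * p%:Z ^+ 2 * m].
Proof.
apply/seteqP; split=> n.
  move=> Sn; have [ev|on] := boolP (2 %| n)%Z; last by left; left; left; left.
  have [/dvdzP[m ->]|[d hd [m ->]]] := S16_even Sn ev.
    by left; left; left; right; exists m => //; rewrite mulrC.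
  case: d / hd => p hp.
  - by left; left; right; exists p, m.
  - by move=> p5; left; right; exists p, m.
  - by move=> p3; right; exists p, m.
case=> [[[[|]|]|]|].
- exact: S16_odd.
- by move=> [m _ <-]; apply: S16_128M.
- by move=> [p [m [hp ->]]]; apply/S16_admissibleM/Admissible1.
- by move=> [p [m [pp [p5 ->]]]]; apply/S16_admissibleM/Admissible5.
- by move=> [p [m [pp [p3 ->]]]]; apply/S16_admissibleM/Admissible3.
Qed.
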